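(* Let $L,M\in\mathbf{C}(x)[\partial]$ be commuting differential operators of orders $n,m>0$, and assume $L,M$ is a true rank $r$ pair. Let $\Gamma$ be the spectral curve of $L,M$. Then for every non-singular point $(\lambda_0,\mu_0)$ of $\Gamma$, the subresultants $\mathcal{L}_k(L-\lambda_0,M-\mu_0)$ vanish identically for $k=0,\dots,r-1$, and $\mathcal{L}_r(L-\lambda_0,M-\mu_0)$ is a differential operator of order $r$ which is a greatest common right divisor of $L-\lambda_0$ and $M-\mu_0$ in $\mathbf{C}(x)[\partial]$ (greatest common right divisors being unique up to left multiplication by a nonzero element of $\mathbf{C}(x)$).
   Context: $\mathbf{C}(x)[\partial]$ is the ring of differential operators with coefficients in $\mathbf{C}(x)$, $\partial=d/dx$, $\partial a=a\partial+a'$. For operators $P,Q$ of orders $n,m$ and $k=0,\dots,\min\{n,m\}-1$, let $S_k(P,Q)$ be the $(n+m-2k)\times(n+m-k)$ coefficient matrix of the operators $\partial^{m-1-k}P,\dots,\partial P,P,\partial^{n-1-k}Q,\dots,\partial Q,Q$ with respect to the monomials $\partial^{n+m-1-k},\dots,\partial,1$. For $i=0,\dots,k$ let $S_k^i$ be the square matrix obtained from $S_k$ by deleting the columns indexed by $\partial^k,\dots,\partial,1$ except the column indexed by $\partial^i$. The $k$-th differential subresultant is $\mathcal{L}_k(P,Q)=\sum_{i=0}^k\det(S_k^i)\partial^i$; the differential resultant is $\partial\mathrm{Res}(P,Q)=\det S_0(P,Q)$. For commuting $L,M$, $f(\lambda,\mu)=\partial\mathrm{Res}(L-\lambda,M-\mu)\in\mathbf{C}[\lambda,\mu]$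 and $f=h^{s}$ with $h$ irreducible, $s$ the rank of the algebra $\mathbf{C}[L,M]$; the spectral curve $\Gamma$ is the plane curve $h=0$. The rank of a set of operators is the gcd of the orders of its elements. $L,M$ is a true rank $r$ pair if $r=\gcd(\mathrm{ord}\,L,\mathrm{ord}\,M)$ equals the rank of the algebra $\mathbf{C}[L,M]$.
   Formalization: Adds the assumption r < min(n,m), since L_k is defined only for k ≤ min(n,m)-1 and L_r is undefined when r = min(n,m) (e.g. L=∂, M=∂²); the parenthetical uniqueness of greatest common right divisors is not restated. *)

(* Defs.v *)
From HB Require Import structures.
From mathcomp Require Import all_boot all_order all_algebra.
Set Implicit Arguments. Unset Strict Implicit. Unset Printing Implicit Defensive.
Import Order.TTheory GRing.Theory Num.Theory.
Local Open Scope ring_scope.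
Local Notation "x %:F" := (@FracField.tofrac _ x).

Definition ratfun (F : fieldType) := {fraction {poly F}}.

Definition derK (F : fieldType) (u : ratfun F) : ratfun F :=
  let r := repr u in
  ((\n_r)^`() * \d_r - \n_r * (\d_r)^`())%:F / ((\d_r) ^+ 2)%:F.

Definition injK (F : fieldType) (c : F) : ratfun F := (c%:P)%:F.

(* Differential operators sum_i a_i d^i in F(x)[d], represented by
   their coefficient list (a polynomial in the formal symbol d = 'X). *)
Definition dop (F : fieldType) := {poly ratfun F}.

Definition ord (F : fieldType) (P : dop F) : nat := (size P).-1.

(* product in F(x)[d]:  d^i a = sum_l C(i,l) a^(l) d^(i-l) *)
Definition dmul (F : fieldType) (P Q : dop F) : dop F :=
  \sum_(i < size P) \sum_(j < size Q) \sum_(l < i.+1)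
     (P`_i * 'C(i, l)%:R * iter l (@derK F) Q`_j) *: 'X^(i - l + j).

Definition dpow (F : fieldType) (P : dop F) (k : nat) : dop F :=
  iter k (dmul P) 1.

Definition cst (F : fieldType) (c : F) : dop F := (injK c)%:P.

(* Bivariate polynomials F[lambda,mu] are {poly {poly F}}: the outer
   variable is mu, the inner variable is lambda.
   H(L,M) = sum_{i,j} h_{ij} L^j M^i. *)
Definition eval_op (F : fieldType) (H : {poly {poly F}}) (L M : dop F) : dop F :=
  \sum_(i < size H) \sum_(j < size H`_i)
     injK (H`_i)`_j *: dmul (dpow L j) (dpow M i).

Definition is_rank_alg (F : fieldType) (L M : dop F) (s : nat) : Prop :=
  (forall H, (s %| ord (eval_op H L M))%N) /\
  (forall d, (forall H, (d %| ord (eval_op H L M))%N) -> (d %| s)%N).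

(* Entries of S_k(P,Q), n = ord P, m = ord Q, where cP j e (resp. cQ j e)
   is the coefficient of d^e in d^j P (resp. d^j Q).  Row a < m-k is
   d^(m-1-k-a) P, row m-k+t is d^(n-1-k-t) Q; column c is indexed by
   the monomial d^(n+m-1-k-c). *)
Definition Sent (R : nzRingType) (n m k : nat) (cP cQ : nat -> nat -> R)
    (a e : nat) : R :=
  if (a < m - k)%N then cP (m - 1 - k - a)%N e
  else cQ (n - 1 - k - (a - (m - k)))%N e.

Definition Smx (R : nzRingType) (n m k : nat) (cP cQ : nat -> nat -> R) :
    'M[R]_(n + m - 2 * k, n + m - k) :=
  \matrix_(a < n + m - 2 * k, c < n + m - k)
     Sent n m k cP cQ a (n + m - 1 - k - c)%N.

(* S_k^i : keep the first n+m-2k-1 columns and the column of d^i *)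
Definition Smx_i (R : nzRingType) (n m k : nat) (cP cQ : nat -> nat -> R)
    (i : nat) : 'M[R]_(n + m - 2 * k) :=
  \matrix_(a < n + m - 2 * k, c < n + m - 2 * k)
     Sent n m k cP cQ a
       (if (c < (n + m - 2 * k).-1)%N then (n + m - 1 - k - c)%N else i).

Definition dcoef (F : fieldType) (P : dop F) (j e : nat) : ratfun F :=
  (dmul 'X^j P)`_e.

Definition subres (F : fieldType) (P Q : dop F) (k : nat) : dop F :=
  \sum_(i < k.+1)
     \det (Smx_i (ord P) (ord Q) k (dcoef P) (dcoef Q) i) *: 'X^i.

(* Differential resultant dRes(L - lambda, M - mu) = det S_0, computed in
   F(x)[lambda,mu] = {poly {poly ratfun F}} (outer var mu, inner lambda). *)
Definition liftK (F : fieldType) (c : ratfun F) : {poly {poly ratfun F}} :=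
  c%:P%:P.
Definition lam (F : fieldType) : {poly {poly ratfun F}} := ('X)%:P.
Definition mu (F : fieldType) : {poly {poly ratfun F}} := 'X.

Definition dres (F : fieldType) (L M : dop F) : {poly {poly ratfun F}} :=
  let n := ord L in let m := ord M in
  let cP := fun j e => liftK (dcoef L j e) - (if e == j then lam F else 0) in
  let cQ := fun j e => liftK (dcoef M j e) - (if e == j then mu F else 0) in
  \det (\matrix_(a < n + m - 2 * 0, c < n + m - 2 * 0)
          Sent n m 0 cP cQ a (n + m - 1 - 0 - c)%N).

Definition liftF (F : fieldType) (f : {poly {poly F}}) : {poly {poly ratfun F}} :=
  map_poly (map_poly (@injK F)) f.

Definition irreducible2 (F : fieldType) (h : {poly {poly F}}) : Prop :=
  h != 0 /\ h \isn't a GRing.unit /\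
  (forall a b : {poly {poly F}}, h = a * b -> a \is a GRing.unit \/ b \is a GRing.unit).

Definition eval2 (F : fieldType) (h : {poly {poly F}}) (l0 m0 : F) : F :=
  (h.[m0%:P]).[l0].

Definition nonsingular_pt (F : fieldType) (h : {poly {poly F}}) (l0 m0 : F) : Prop :=
  eval2 h l0 m0 = 0 /\
  (eval2 (map_poly (fun p : {poly F} => p^`()) h) l0 m0 != 0 \/
   eval2 (h^`()) l0 m0 != 0).

Definition rdivides (F : fieldType) (D A : dop F) : Prop :=
  exists C : dop F, A = dmul C D.

Definition is_gcrd (F : fieldType) (D A B : dop F) : Prop :=
  rdivides D A /\ rdivides D B /\
  (forall E, rdivides E A -> rdivides E B -> rdivides E D).

(* Main.v *)
(* Write D = F(x)[∂], P = L - l0, Q = M - m0, n = ord L. Right multiplication by M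
   acts on the n-dimensional space D / DP by a matrix T, and eliminating the rows
   of Q in the Sylvester matrix S_0 shows that f(l0, μ) is the characteristic
   polynomial of T up to a nonzero factor. By Cayley-Hamilton f(L, M) lies in
   D(L - l) for every constant l, hence f(L, M) = 0 and, D being a domain,
   h(L, M) = 0. If m0 is a simple root of h(l0, μ), then m0 is a semisimple
   eigenvalue of T of multiplicity s, so T - m0 has rank n - s. This bounds below
   the order of every nonzero element of DP + DQ (by s) and of every V != 0 with
   VQ in DP (by n - s). The case of a simple root in λ is symmetric.

   The degree of f(l0, μ) gives s | n, and likewise s | m. Conversely, commuting
   operators of the same order have leading coefficients with constant ratio, and
   all orders in F[L, M] are multiples of r; counting the monomials L^i M^j with
   j <= n / r yields a relation of degree at most n / r in μ, which h divides by a
   Gauss lemma argument. Hence s >= r, and s = r.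

   The subresultant L_k is a combination of the rows of S_k, so it lies in DP + DQ
   and vanishes for k < r. For k = r a kernel vector of S_r^r would give U, V of
   small order with UP + VQ of order < r, which the two bounds exclude. Thus L_r
   has order exactly r, and it divides P and Q on the right because the remainders
   are elements of DP + DQ of order < r. *)
Require Import Defs.
From HB Require Import structures.
From mathcomp Require Import all_boot all_order all_algebra.
From mathcomp Require Import perm ring zify.
Set Implicit Arguments. Unset Strict Implicit. Unset Printing Implicit Defensive.
Import Order.TTheory GRing.Theory Num.Theory.
Local Open Scope ring_scope.

(** * Rational functions: the quotient rule and the constants of the derivation *)

Lemma quotient_rule_well_defined (R : comPzRingType) (n n' d d' p p' q q' : R) :
  n * q = p * d -> n' * q + n * q' = p' * d + p * d' ->
  (n' * d - n * d') * q ^+ 2 = (p' * q - p * q') * d ^+ 2.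
Proof.
move=> E E'.
have -> : (n' * d - n * d') * q ^+ 2 =
          d * q * (n' * q + n * q') - (n * q) * (d' * q + d * q') by ring.
by rewrite E' E; ring.
Qed.

Lemma quotient_ruleD (R : fieldType) (p p' q q' a a' b b' : R) :
  q != 0 -> b != 0 ->
  ((p' * b + p * b' + (a' * q + a * q')) * (q * b)
     - (p * b + a * q) * (q' * b + q * b')) / (q * b) ^+ 2 =
  (p' * q - p * q') / q ^+ 2 + (a' * b - a * b') / b ^+ 2.
Proof. by move=> q0 b0; field; rewrite q0 b0. Qed.

Lemma quotient_ruleM (R : fieldType) (p p' q q' a a' b b' : R) :
  q != 0 -> b != 0 ->
  ((p' * a + p * a') * (q * b) - (p * a) * (q' * b + q * b')) / (q * b) ^+ 2 =
  (p' * q - p * q') / q ^+ 2 * (a / b) + p / q * ((a' * b - a * b') / b ^+ 2).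
Proof. by move=> q0 b0; field; rewrite q0 b0. Qed.

Section RationalFunctions.
Variable F : fieldType.
Local Notation K := (ratfun F).
Local Notation "x %:F" := (@FracField.tofrac _ x).
Implicit Types (u v : K) (p q : {poly F}).

Lemma ratfun_repr u : u = (\n_(repr u))%:F / (\d_(repr u))%:F.
Proof.
apply: (canRL (mulfK _)); first by rewrite tofrac_eq0 denom_ratioP.
rewrite -[X in X * _]reprK; set r := repr u.
have d0 := denom_ratioP r.
unlock FracField.tofrac; rewrite -[LHS]FracField.pi_mul.
apply/eqmodP => /=; rewrite FracField.equivfE /FracField.mulf.
rewrite !numden_Ratio ?mulr1 ?oner_eq0 ?mulf_neq0 ?oner_eq0 //.
by rewrite mulrC.
Qed.

Lemma ratfunP u : exists p q, q != 0 /\ u = p%:F / q%:F.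
Proof.
by exists \n_(repr u), \d_(repr u); split; [exact: denom_ratioP | exact: ratfun_repr].
Qed.

(** [derK] is defined on the representative n/d picked by [repr]. Any other one satisfies p d = n q,
    and this equation with its derivative makes the two quotient rules agree. *)
Lemma derK_frac p q : q != 0 ->
  derK (p%:F / q%:F) = (p^`() * q - p * q^`())%:F / (q ^+ 2)%:F :> K.
Proof.
move=> q0; rewrite /derK /=; set r := repr _.
have d0 : \d_r != 0 := denom_ratioP r.
have Fq0 : q%:F != 0 :> K by rewrite tofrac_eq0.
have Fd0 : (\d_r)%:F != 0 :> K by rewrite tofrac_eq0.
have /eqP : p%:F / q%:F = (\n_r)%:F / (\d_r)%:F := ratfun_repr _.
rewrite eqr_div; [|exact: Fq0|exact: Fd0].
rewrite -tofracM.
rewrite -tofracM.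
rewrite tofrac_eq => /eqP/esym E.
have E' := congr1 (@deriv F) E; rewrite !derivM in E'.
apply/eqP; rewrite eqr_div ?tofrac_eq0 ?expf_neq0 // -!tofracM tofrac_eq.
by apply/eqP; apply: quotient_rule_well_defined.
Qed.

Lemma derKD u v : derK (u + v) = derK u + derK v.
Proof.
have [p [q [q0 ->]]] := ratfunP u; have [a [b [b0 ->]]] := ratfunP v.
have Fq0 : q%:F != 0 :> K by rewrite tofrac_eq0.
have Fb0 : b%:F != 0 :> K by rewrite tofrac_eq0.
rewrite addf_div; [|exact: Fq0|exact: Fb0].
rewrite -[p%:F * b%:F]tofracM -[a%:F * q%:F]tofracM -tofracD -[q%:F * b%:F]tofracM.
rewrite (derK_frac p q0) (derK_frac a b0) (derK_frac _ (mulf_neq0 q0 b0)).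
rewrite derivD 3!derivM 3!tofracB 3!tofracXn 6!tofracM 5!tofracD 10!tofracM.
exact: (@quotient_ruleD K p%:F (p^`())%:F q%:F (q^`())%:F a%:F (a^`())%:F b%:F (b^`())%:F Fq0 Fb0).
Qed.

Lemma derKM u v : derK (u * v) = derK u * v + u * derK v.
Proof.
have [p [q [q0 ->]]] := ratfunP u; have [a [b [b0 ->]]] := ratfunP v.
have Fq0 : q%:F != 0 :> K by rewrite tofrac_eq0.
have Fb0 : b%:F != 0 :> K by rewrite tofrac_eq0.
rewrite mulf_div -[p%:F * a%:F]tofracM -[q%:F * b%:F]tofracM.
rewrite (derK_frac p q0) (derK_frac a b0) (derK_frac _ (mulf_neq0 q0 b0)).
rewrite 2!derivM 3!tofracB 3!tofracXn 4!tofracM 2!tofracD 9!tofracM.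
exact: (@quotient_ruleM K p%:F (p^`())%:F q%:F (q^`())%:F a%:F (a^`())%:F b%:F (b^`())%:F Fq0 Fb0).
Qed.

Lemma injK_is_zmod_morphism : zmod_morphism (@injK F).
Proof. by move=> a b; rewrite /injK polyCB tofracB. Qed.

Lemma injK_is_monoid_morphism : monoid_morphism (@injK F).
Proof. by split=> [|a b]; rewrite /injK ?polyC1 ?tofrac1 // polyCM tofracM. Qed.

HB.instance Definition _ :=
  GRing.isZmodMorphism.Build F K (@injK F) injK_is_zmod_morphism.
HB.instance Definition _ :=
  GRing.isMonoidMorphism.Build F K (@injK F) injK_is_monoid_morphism.

Lemma derK_injK (c : F) : derK (injK c) = 0.
Proof.
have := derK_frac c%:P (oner_neq0 _); rewrite tofrac1 divr1 -/(injK c) => ->.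
by rewrite derivC -polyC1 derivC mul0r mulr0 subrr tofrac0 mul0r.
Qed.

Lemma deriv_eq0_const p : [pchar F] =i pred0 -> p^`() = 0 -> (size p <= 1)%N.
Proof.
move=> c0 /polyP dp0; apply/leq_sizeP => -[|i] // _.
have := dp0 i; rewrite coef_deriv coef0 -mulr_natr => /eqP.
by rewrite mulf_eq0 (pcharf0P F).1 // orbF => /eqP.
Qed.

(** In lowest terms a/b, a zero derivative means a' b = a b'. Coprimality gives b | b', so b' = 0 by
    degree, then a' = 0; in characteristic 0 both a and b are constants. *)
Lemma derK_eq0 u : [pchar F] =i pred0 -> derK u = 0 -> exists c, u = injK c.
Proof.
move=> c0; have [p [q [q0 ->]]] := ratfunP u.
pose g := gcdp p q; have g0 : g != 0 by rewrite gcdp_eq0 negb_and q0 orbT.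
have Ep : p = (p %/ g) * g by rewrite divpK ?dvdp_gcdl.
have Eq : q = (q %/ g) * g by rewrite divpK ?dvdp_gcdr.
have cop : coprimep (p %/ g) (q %/ g).
  by apply: coprimep_div_gcd; rewrite q0 orbT.
move: Ep Eq cop; set a := p %/ g; set b := q %/ g => Ep Eq cop.
have b0 : b != 0 by apply: contraNneq q0 => b0; rewrite Eq b0 mul0r.
have -> : p%:F / q%:F = a%:F / b%:F :> K.
  by rewrite Ep Eq !tofracM -mulf_div divff ?mulr1 // tofrac_eq0.
rewrite derK_frac // => /eqP; rewrite mulf_eq0 invr_eq0 !tofrac_eq0.
rewrite expf_eq0 (negPf b0) andbF orbF subr_eq0 => /eqP E.
have b'0 : b^`() = 0.
  have : b %| b^`().
    by rewrite -(Gauss_dvdpr _ (q := a)) 1?coprimep_sym // -E dvdp_mull.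
  move/dvdp_leq => le; apply/eqP; apply: contraT => /le.
  by rewrite leqNgt lt_size_deriv.
have a'0 : a^`() = 0.
  by move/eqP: E; rewrite b'0 mulr0 mulf_eq0 (negPf b0) orbF => /eqP.
have /size1_polyC Ea := deriv_eq0_const c0 a'0.
have /size1_polyC Eb := deriv_eq0_const c0 b'0.
exists (a`_0 / b`_0); rewrite fmorph_div {1}Ea {1}Eb //.
Qed.
End RationalFunctions.

(** * The ring of differential operators over a field with a derivation *)

Record derivation (K : fieldType) := Derivation {
  der_fun :> K -> K;
  derD : {morph der_fun : u v / u + v};
  derM : forall u v, der_fun (u * v) = der_fun u * v + u * der_fun v }.

Section DerivationTheory.
Variables (K : fieldType) (d : derivation K).

Lemma der_is_zmod_morphism : zmod_morphism d.
Proof.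
have d0 : d 0 = 0 by apply: (addrI (d 0)); rewrite -derD !addr0.
have dN u : d (- u) = - d u by apply: (addrI (d u)); rewrite -derD !subrr.
by move=> u v; rewrite derD dN.
Qed.

HB.instance Definition _ :=
  GRing.isZmodMorphism.Build K K (der_fun d) der_is_zmod_morphism.

Lemma der1 : d 1 = 0.
Proof. by apply: (addrI (d 1)); rewrite addr0 -{3}[1]mulr1 derM mulr1 mul1r. Qed.
End DerivationTheory.

(** An alias of [{poly K}] tagged by [d]: it carries the noncommutative product, while [{poly K}]
    keeps the commutative one along with sizes and coefficients. *)
Definition diffop (K : fieldType) (d : derivation K) := {poly K}.

HB.instance Definition _ (K : fieldType) (d : derivation K) :=
  GRing.Lmodule.copy (diffop d) {poly K}.

Section DiffopRing.
Variables (K : fieldType) (d : derivation K).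
Local Notation D := (diffop d).
Implicit Types (P Q R : {poly K}).

(* Left multiplication by the operator ∂ *)
Definition ddmul Q : {poly K} := map_poly d Q + 'X * Q.

Lemma ddmul_is_zmod_morphism : zmod_morphism ddmul.
Proof. by move=> P Q; rewrite /ddmul raddfB mulrBr opprD addrACA. Qed.
HB.instance Definition _ :=
  GRing.isZmodMorphism.Build {poly K} {poly K} ddmul ddmul_is_zmod_morphism.

Lemma ddmulZ (c : K) Q : ddmul (c *: Q) = d c *: Q + c *: ddmul Q.
Proof.
rewrite /ddmul -scalerAr scalerDr addrA; congr (_ + _).
by apply/polyP=> i; rewrite coefD !(coef_map_id0, coefZ) ?raddf0 //= derM.
Qed.

Definition diffop_mul P Q : {poly K} := \sum_(i < size P) P`_i *: iter i ddmul Q.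

Lemma iter_ddmul_zmod n : zmod_morphism (iter n ddmul).
Proof. by elim: n => [//|n IH] P Q; rewrite !iterS (IH P Q) raddfB. Qed.

Lemma diffop_mulE n P Q : (size P <= n)%N ->
  diffop_mul P Q = \sum_(i < n) P`_i *: iter i ddmul Q.
Proof.
move=> le; rewrite /diffop_mul.
rewrite (big_ord_widen n (fun i => P`_i *: iter i ddmul Q)) // big_mkcond /=.
by apply: eq_bigr => i _; case: ltnP => // /(nth_default 0) ->; rewrite scale0r.
Qed.

Lemma diffop_mulDl : left_distributive diffop_mul +%R.
Proof.
move=> P P' Q; pose n := maxn (size P) (size P').
rewrite !(@diffop_mulE n) ?leq_maxl ?leq_maxr ?size_polyD //.
rewrite -big_split; apply: eq_bigr => i _; by rewrite coefD scalerDl.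
Qed.

Lemma diffop_mulBr P : zmod_morphism (diffop_mul P).
Proof.
move=> Q Q'; rewrite /diffop_mul -sumrB; apply: eq_bigr => i _.
by rewrite iter_ddmul_zmod scalerBr.
Qed.
HB.instance Definition _ P :=
  GRing.isZmodMorphism.Build {poly K} {poly K} (diffop_mul P) (diffop_mulBr P).

Lemma diffop_mulDr : right_distributive diffop_mul +%R.
Proof. by move=> P Q Q'; rewrite raddfD. Qed.

Lemma diffop_mulZl (c : K) P Q : diffop_mul (c *: P) Q = c *: diffop_mul P Q.
Proof.
rewrite (@diffop_mulE (size P)) ?size_scale_leq // scaler_sumr.
by apply: eq_bigr => i _; rewrite coefZ scalerA.
Qed.

Lemma diffop_mulXn i Q : diffop_mul 'X^i Q = iter i ddmul Q.
Proof.
rewrite /diffop_mul size_polyXn big_ord_recr /= coefXn eqxx scale1r.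
rewrite big1 ?add0r // => j _.
by rewrite coefXn ltn_eqF ?scale0r // ltn_ord.
Qed.

Lemma diffop_mul1 : left_id 1 diffop_mul.
Proof. by move=> Q; rewrite -(expr0 'X) diffop_mulXn. Qed.

Lemma ddmulXn i : ddmul 'X^i = 'X^(i.+1).
Proof.
rewrite /ddmul exprS -[RHS]add0r; congr (_ + _).
apply/polyP=> j; rewrite coef_map_id0 ?raddf0 // coefXn coef0.
by case: eqP; rewrite ?raddf0 // der1.
Qed.

Lemma diffop_mulr1 : right_id 1 diffop_mul.
Proof.
move=> P; rewrite -[RHS]coefK poly_def; apply: eq_bigr => i _.
congr (_ *: _); elim: (i : nat) => //= n ->; exact: ddmulXn.
Qed.

Lemma diffop_mul_suml I (r : seq I) (p : pred I) (f : I -> {poly K}) Q :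
  diffop_mul (\sum_(i <- r | p i) f i) Q = \sum_(i <- r | p i) diffop_mul (f i) Q.
Proof.
apply: (big_morph (fun P => diffop_mul P Q)) => [P P'|]; first exact: diffop_mulDl.
by rewrite /diffop_mul size_poly0 big_ord0.
Qed.

(** By additivity one may take P = c ∂^i, where both sides are c' ∂^i Q + c ∂^(i+1) Q. Iterating
    this gives associativity. *)
Lemma diffop_mul_ddmul P Q : diffop_mul (ddmul P) Q = ddmul (diffop_mul P Q).
Proof.
rewrite -[P]coefK poly_def raddf_sum diffop_mul_suml diffop_mul_suml raddf_sum.
apply: eq_bigr => i _ /=.
rewrite ddmulZ ddmulXn diffop_mulDl !diffop_mulZl !diffop_mulXn.
by rewrite ddmulZ.
Qed.

Lemma diffop_mulA : associative diffop_mul.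
Proof.
move=> P Q R; rewrite {2}/diffop_mul diffop_mul_suml; apply: eq_bigr => i _.
rewrite diffop_mulZl; congr (_ *: _).
by elim: (i : nat) => //= n ->; rewrite diffop_mul_ddmul.
Qed.

HB.instance Definition _ := GRing.Zmodule_isNzRing.Build D
  diffop_mulA diffop_mul1 diffop_mulr1 diffop_mulDl diffop_mulDr (oner_neq0 {poly K}).

Lemma diffop_scaleAl (c : K) (P Q : D) : c *: (P * Q) = ((c *: P : D) * Q : D).
Proof. exact/esym/(diffop_mulZl c P Q). Qed.

HB.instance Definition _ := GRing.Lmodule_isLalgebra.Build K D diffop_scaleAl.
End DiffopRing.

(** * Orders, right division, and the quotient space D / DP *)

Section DiffopDivision.
Variables (K : fieldType) (d : derivation K).
Local Notation D := (diffop d).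
Implicit Types (P Q R X B C : D).

Definition partial (i : nat) : D := 'X^i.

Lemma size_partial i : size (partial i) = i.+1.
Proof. exact: size_polyXn. Qed.

Lemma partial_neq0 i : partial i != 0.
Proof. by rewrite -size_poly_gt0 size_partial. Qed.

Lemma diffop_sum_coef n X : (size X <= n)%N -> X = \sum_(i < n) X`_i *: partial i.
Proof.
move=> leX; rewrite -poly_def; apply/polyP => i; rewrite coef_poly.
by case: ltnP => // lei; rewrite nth_default // (leq_trans leX).
Qed.

Lemma size_ddmul (Q : {poly K}) : Q != 0 -> size (ddmul d Q) = (size Q).+1.
Proof.
move=> Q0; rewrite /ddmul addrC mulrC size_polyDl size_mulX // ltnS.
exact: size_poly.
Qed.

Lemma lead_coef_ddmul (Q : {poly K}) : Q != 0 -> lead_coef (ddmul d Q) = lead_coef Q.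
Proof.
move=> Q0; rewrite /ddmul addrC mulrC lead_coefDl ?lead_coefMX // size_mulX // ltnS.
exact: size_poly.
Qed.

Lemma iter_ddmul_lead n (Q : {poly K}) : Q != 0 ->
  size (iter n (ddmul d) Q) = (n + size Q)%N /\
  lead_coef (iter n (ddmul d) Q) = lead_coef Q.
Proof.
move=> Q0; elim: n => [|n [IHs IHl]] //; rewrite iterS.
have nz : iter n (ddmul d) Q != 0 by rewrite -lead_coef_eq0 IHl lead_coef_eq0.
by rewrite size_ddmul // lead_coef_ddmul // IHs IHl.
Qed.

Lemma size_diffop_sum_lt n (P Q : {poly K}) : Q != 0 ->
  (size (\sum_(i < n) P`_i *: iter i (ddmul d) Q)%R < n + size Q)%N.
Proof.
move=> Q0; elim: n => [|n IH]; first by rewrite big_ord0 size_poly0 size_poly_gt0.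
rewrite big_ord_recr /=; apply: leq_ltn_trans (size_polyD _ _) _.
rewrite gtn_max; apply/andP; split; first exact: ltn_trans IH _.
apply: leq_ltn_trans (size_scale_leq _ _) _.
by rewrite (iter_ddmul_lead n Q0).1.
Qed.

(** Each ∂^i Q has order i + ord Q and the leading coefficient of Q, so the top term of P dominates
    the sum. *)
Lemma diffop_mul_lead P Q : P != 0 -> Q != 0 ->
  size (P * Q) = (size P + size Q).-1 /\
  lead_coef (P * Q) = lead_coef P * lead_coef Q.
Proof.
move=> P0 Q0; have : (0 < size P)%N by rewrite size_poly_gt0.
rewrite [P * Q]/(diffop_mul d P Q) /diffop_mul [lead_coef P]/lead_coef.
have : P`_(size P).-1 != 0 by rewrite -[_`__]/(lead_coef P) lead_coef_eq0.
case: (size P) => // n /= Pn0 _; rewrite big_ord_recr /=.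
have [hs hl] := iter_ddmul_lead n Q0.
have lt : (size (\sum_(i < n) P`_i *: iter i (ddmul d) Q)%R
           < size (P`_n *: iter n (ddmul d) Q)%R)%N.
  by rewrite size_scale // hs; apply: size_diffop_sum_lt.
by rewrite addrC size_polyDl // lead_coefDl // size_scale // lead_coefZ hs hl.
Qed.

Lemma size_diffop_mul P Q : P != 0 -> Q != 0 ->
  size (P * Q) = (size P + size Q).-1.
Proof. by move=> P0 Q0; case: (diffop_mul_lead P0 Q0). Qed.

Lemma diffop_mul_eq0 P Q : (P * Q == 0) = (P == 0) || (Q == 0).
Proof.
have [->|P0] := eqVneq P 0; first by rewrite mul0r eqxx.
have [->|Q0] := eqVneq Q 0; first by rewrite mulr0 eqxx.
apply/eqP => PQ0; have := (diffop_mul_lead P0 Q0).2.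
by rewrite PQ0 lead_coef0 => /esym/eqP; rewrite mulf_eq0 !lead_coef_eq0 (negPf P0) (negPf Q0).
Qed.

Lemma diffop_expf_eq0 P n : P ^+ n = 0 -> P = 0.
Proof.
elim: n => [/eqP|n IH]; first by rewrite expr0 oner_eq0.
by rewrite exprS => /eqP; rewrite diffop_mul_eq0 => /orP[/eqP|/eqP/IH].
Qed.

Lemma size_sub_same_lead (p q : {poly K}) : p != 0 -> size p = size q ->
  lead_coef p = lead_coef q -> (size (p - q)%R < size p)%N.
Proof.
move=> p0 eqs eql; rewrite -size_poly_gt0 in p0.
rewrite -[X in (_ < X)%N](prednK p0) ltnS; apply/leq_sizeP => j lej.
rewrite coefB; move: lej; rewrite leq_eqVlt => /predU1P[<-|].
  by rewrite {2}eqs -!/(lead_coef _) eql subrr.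
by rewrite prednK // => ltj; rewrite !nth_default ?subrr // -eqs.
Qed.

Lemma right_division P X :
  {CR : D * D | X = CR.1 * P + CR.2 & P != 0 -> (size CR.2 < size P)%N}.
Proof.
have [->|P0] := eqVneq P 0.
  by exists (0, X) => /=; rewrite ?mulr0 ?add0r ?eqxx.
have [N] := ubnP (size X); elim: N => // N IH in X *; rewrite ltnS => leX.
have [ltX|leP] := ltnP (size X) (size P).
  by exists (0, X); rewrite ?mul0r ?add0r.
have P1 : (0 < size P)%N by rewrite size_poly_gt0.
have X0 : X != 0 by rewrite -size_poly_gt0 (leq_trans P1).
(* Since ∂^i P has the leading coefficient of P, subtracting c ∂^i P, with i the difference of the
   orders, cancels the leading term of X. *)
pose c := lead_coef X / lead_coef P.
have c0 : c != 0 by rewrite mulf_neq0 ?invr_eq0 ?lead_coef_eq0.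
pose T : D := c *: partial (size X - size P).
have T0 : T != 0 by rewrite scaler_eq0 negb_or c0 partial_neq0.
have [sT lT] := diffop_mul_lead T0 P0.
have [|[C R] /= E ltR] := IH (X - T * P).
  apply: leq_trans leX; apply: size_sub_same_lead => //.
    by rewrite sT size_scale // size_partial addSn /= subnK.
  by rewrite lT lead_coefZ lead_coefXn mulr1 divfK // lead_coef_eq0.
exists (C + T, R) => //=.
by rewrite mulrDl addrAC -E subrK.
Qed.

Definition dquo P X : D := (s2val (right_division P X)).1.
Definition drem P X : D := (s2val (right_division P X)).2.

Lemma ddivE P X : X = dquo P X * P + drem P X.
Proof. exact: (s2valP (right_division P X)). Qed.

Lemma size_drem P X : P != 0 -> (size (drem P X) < size P)%N.
Proof. exact: (s2valP' (right_division P X)). Qed.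

Lemma right_multiple_small P C : (size (C * P)%R < size P)%N -> C = 0.
Proof.
have [->|C0] := eqVneq C 0 => //; have [->|P0] := eqVneq P 0; first by rewrite mulr0 ltnn.
rewrite size_diffop_mul // -ltnS prednK; last by rewrite addn_gt0 size_poly_gt0 C0.
by rewrite ltnS -{2}[size P]add0n leq_add2r leqn0 size_poly_eq0 (negPf C0).
Qed.

Lemma drem_unique P X C R : X = C * P + R -> (size R < size P)%N -> drem P X = R.
Proof.
move=> E ltR; have P0 : P != 0 by rewrite -size_poly_gt0 (leq_ltn_trans _ ltR).
have EE : (C - dquo P X) * P = drem P X - R.
  apply/eqP; rewrite mulrBl subr_eq addrAC -subr_eq opprK -E.
  by rewrite addrC -ddivE.
have /right_multiple_small : (size ((C - dquo P X) * P)%R < size P)%N.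
  rewrite EE; apply: leq_ltn_trans (size_polyD _ _) _.
  by rewrite size_polyN gtn_max size_drem.
by move=> C0; move/eqP: EE; rewrite C0 mul0r eq_sym subr_eq0 => /eqP.
Qed.

Lemma drem_small P X : (size X < size P)%N -> drem P X = X.
Proof. by move=> lt; apply: (@drem_unique _ _ 0) => //; rewrite mul0r add0r. Qed.

Lemma drem_linear P (a : K) X Y : P != 0 ->
  drem P (a *: X + Y) = a *: drem P X + drem P Y.
Proof.
move=> P0; apply: (@drem_unique _ _ (a *: dquo P X + dquo P Y)).
  rewrite mulrDl -scalerAl addrACA -scalerDr -!ddivE //.
apply: leq_ltn_trans (size_polyD _ _) _; rewrite gtn_max size_drem // andbT.
exact: leq_ltn_trans (size_scale_leq _ _) (size_drem _ P0).
Qed.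

Lemma drem_eq0 P X : drem P X = 0 -> X = dquo P X * P.
Proof. by move=> r0; rewrite {1}(ddivE P X) r0 addr0. Qed.

Section Quotient.
Variables (n : nat) (P : D).
Hypothesis sP : size P = n.+1.

Let P0 : P != 0. Proof. by rewrite -size_poly_gt0 sP. Qed.

(* Class of X in the n-dimensional left K-space D / DP, in the basis 1, ∂, ..., ∂^(n-1) *)
Definition remrow X : 'rV[K]_n := poly_rV (drem P X).

Lemma remrow_linear (a : K) X Y : remrow (a *: X + Y) = a *: remrow X + remrow Y.
Proof. by rewrite /remrow drem_linear // linearP. Qed.

Lemma remrowD X Y : remrow (X + Y) = remrow X + remrow Y.
Proof. by rewrite -[X]scale1r remrow_linear !scale1r. Qed.

Lemma remrow_small X : (size X <= n)%N -> remrow X = poly_rV X.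
Proof. by move=> leX; rewrite /remrow drem_small // sP. Qed.

Lemma remrow0 : remrow 0 = 0.
Proof. by rewrite remrow_small ?size_poly0 // raddf0. Qed.

Lemma remrowZ (a : K) X : remrow (a *: X) = a *: remrow X.
Proof. by rewrite -[a *: X]addr0 remrow_linear remrow0 addr0. Qed.

Lemma remrowB X Y : remrow (X - Y) = remrow X - remrow Y.
Proof. by rewrite -scaleN1r addrC remrow_linear scaleN1r addrC. Qed.

Lemma remrow_sum k (a : 'I_k -> K) (X : 'I_k -> D) :
  remrow (\sum_i a i *: X i) = \sum_i a i *: remrow (X i).
Proof.
apply: (big_ind2 (fun X r => remrow X = r)) => [|X1 Y1 X2 Y2 <- <-|i _].
- exact: remrow0.
- exact: remrowD.
- exact: remrowZ.
Qed.

Lemma remrow_mulP C : remrow (C * P) = 0.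
Proof.
rewrite /remrow (@drem_unique _ _ C 0) ?addr0 ?size_poly0 ?sP //.
exact: raddf0.
Qed.

Lemma remrow_eq0 X : remrow X = 0 -> exists C, X = C * P.
Proof.
move=> r0; exists (dquo P X); apply: drem_eq0.
rewrite -[drem P X](@poly_rV_K _ n) -?/(remrow X) ?r0 ?raddf0 //.
by have := size_drem X P0; rewrite sP.
Qed.

(* Right multiplication by B on D / DP, well defined when B commutes with P *)
Definition opmx B : 'M[K]_n := \matrix_(i < n) remrow (partial i * B).

(** Write X = C P + R. Commutation turns C P B into (C B) P, an element of DP, so only R B matters,
    and R expands in the basis ∂^i. *)
Lemma remrow_mul X B : P * B = B * P -> remrow (X * B) = remrow X *m opmx B.
Proof.
move=> cPB; rewrite {1}(ddivE P X) mulrDl -mulrA cPB mulrA remrowD remrow_mulP add0r.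
rewrite /remrow -/(remrow (drem P X * B)).
have leR : (size (drem P X) <= n)%N by have := size_drem X P0; rewrite sP.
move: (drem P X) leR => R leR; rewrite mulmx_sum_row.
rewrite {1}(diffop_sum_coef leR) mulr_suml; under eq_bigr => i _ do rewrite -scalerAl.
rewrite remrow_sum; apply: eq_bigr => i _; by rewrite rowK [poly_rV R 0 i]mxE.
Qed.

(* The derivatives ∂^j V with j + ord V < n are independent modulo DP *)
Lemma left_ideal_rank (V : D) (W : 'M[K]_n) : V != 0 -> (size V <= n)%N ->
  (forall j, (remrow (partial j * V)%R <= W)%MS) -> (n < \rank W + size V)%N.
Proof.
move=> V0 leV subW; set v := (size V).-1.
have V1 : (0 < size V)%N by rewrite size_poly_gt0.
pose A : 'M[K]_(n - v, n) := \matrix_(j < n - v) remrow (partial j * V).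
have AW : (A <= W)%MS by apply/row_subP => j; rewrite rowK.
have sXV (j : nat) : size (partial j * V) = (j + size V)%N.
  by rewrite size_diffop_mul ?size_partial ?partial_neq0.
have Afree : row_free A.
  (* A relation u between the rows says that the operator [rVpoly u] times V has remainder 0. Its
     order is below n, so it is its own remainder and vanishes; as V is nonzero, u = 0. *)
  rewrite -kermx_eq0; apply/rowV0P => u /sub_kermxP uA0.
  have : (rVpoly u : D) * V = 0.
    have -> : (rVpoly u : D) * V = \sum_(j < n - v) u 0 j *: (partial j * V).
      have -> : rVpoly u = \sum_(j < n - v) u 0 j *: partial j.
        rewrite (@diffop_sum_coef (n - v) (rVpoly u)) ?size_poly //.
        by apply: eq_bigr => j _; rewrite coef_rVpoly_ord.
      by rewrite mulr_suml; apply: eq_bigr => j _; rewrite scalerAl.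
    set Y := \sum_(j < _) _.
    have leY : (size Y <= n)%N.
      apply: leq_trans (size_sum _ _ _) _; apply/bigmax_leqP => j _.
      apply: leq_trans (size_scale_leq _ _) _; rewrite sXV.
      by rewrite -(prednK V1) -/v addnS addnC -ltn_subRL.
    rewrite -[Y](@poly_rV_K _ n) // -remrow_small // remrow_sum.
    under eq_bigr => j _ do
      rewrite -[remrow _](rowK (fun j : 'I_(n - v) => remrow (partial j * V))) -/A.
    by rewrite -mulmx_sum_row uA0 raddf0.
  move/eqP; rewrite diffop_mul_eq0 (negPf V0) orbF => /eqP u0.
  by rewrite -[u]rVpolyK u0 raddf0.
have := mxrankS AW; rewrite (eqP Afree) leq_subLR.
by rewrite -(prednK V1) -/v addnS ltnS addnC.
Qed.
End Quotient.
End DiffopDivision.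

(** * Linear algebra: the rank of T - a at a simple root a *)

Section SimpleEigenvalue.
Variable K : fieldType.

(** The base change [W] carries X - T to the block diagonal matrix with blocks X - a and X - T2; its
    determinant is a nonzero constant and cancels. *)
Lemma char_poly_direct_sum n k l (T : 'M[K]_n) (A : 'M[K]_(k, n)) (B : 'M[K]_(l, n))
    (a : K) (T2 : 'M[K]_l) (e : (k + l)%N = n) :
  row_full (col_mx A B) -> A *m T = a *: A -> B *m T = T2 *m B ->
  char_poly T = ('X - a%:P) ^+ k * char_poly T2.
Proof.
case: n / e T A B => T A B full AT BT.
pose W := map_mx (@polyC K) (col_mx A B).
have W0 : \det W != 0.
  by rewrite det_map_mx polyC_eq0 -unitfE -unitmxE -row_full_unit.
have E : W *m char_poly_mx T = block_mx ('X - a%:P)%:M 0 0 (char_poly_mx T2) *m W.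
  rewrite /char_poly_mx mulmxBr -map_mxM mul_col_mx AT BT.
  rewrite /W map_col_mx mul_block_col !mul0mx addr0 add0r map_col_mx.
  rewrite mul_mx_scalar scale_col_mx opp_col_mx add_col_mx; congr col_mx.
    by rewrite map_mxZ mul_scalar_mx -scalerBl.
  by rewrite map_mxM mulmxBl mul_scalar_mx.
have := congr1 determinant E; rewrite !det_mulmx det_lblock det_scalar.
by rewrite mulrC => /(mulIf W0).
Qed.

Lemma expX_factor_uniq (a : K) (p q : {poly K}) i j :
  ~~ root p a -> ~~ root q a ->
  ('X - a%:P) ^+ i * p = ('X - a%:P) ^+ j * q -> i = j.
Proof.
wlog le : p q i j / (i <= j)%N => [W pa qa E|].
  by have [le|/ltnW le] := leqP i j; [apply: (W p q)|apply/esym/(W q p)].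
move=> pa qa /eqP; rewrite -(subnK le) exprD mulrAC [X in _ == X]mulrC.
rewrite (inj_eq (mulfI _)) ?expf_neq0 ?polyXsubC_eq0 // => /eqP pE.
case: (j - i)%N pE => // t pE; case/negP: pa.
by rewrite pE rootM exprS rootM root_XsubC eqxx.
Qed.

(** As X - a and g are coprime and their product kills T, the space is the direct sum of ker (T - a)
    and ker g(T). The exponent of X - a in the characteristic polynomial is then the dimension of
    the first summand, and it is also s. *)
Lemma eigenspace_rank_simple_root n (T : 'M[K]_n.+1) (a c : K) (g : {poly K}) s :
  c != 0 -> horner_mx T (('X - a%:P) * g) = 0 -> ~~ root g a ->
  char_poly T = c *: (('X - a%:P) * g) ^+ s ->
  \rank (T - a%:M) = (n.+1 - s)%N /\ (s <= n.+1)%N.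
Proof.
move=> c0 T0 ga chT.
have cop : coprimep ('X - a%:P) g by rewrite coprimep_sym coprimep_XsubC.
pose E := kermxpoly T ('X - a%:P); pose G := kermxpoly T g.
have EE : (E + G :=: 1%:M)%MS.
  apply: eqmx_trans (eqmx_sym (kermxpolyM T cop)) _.
  by apply: kermxpoly_min; apply/mxminpoly_minP.
have dEG : (E :&: G = 0)%MS by apply: mxdirect_kermxpoly.
have rEG : (\rank E + \rank G)%N = n.+1.
  by rewrite -(mxrank_sum_cap E G) dEG mxrank0 addn0 EE mxrank1.
have hE : horner_mx T ('X - a%:P) = T - a%:M.
  by rewrite rmorphB /= horner_mx_X horner_mx_C.
pose A := row_base E; pose B := row_base G.
have full : row_full (col_mx A B).
  rewrite -sub1mx -addsmxE.
  by rewrite (adds_eqmx (eq_row_base E) (eq_row_base G)) EE.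
have AT : A *m T = a *: A.
  have : A *m (T - a%:M) = 0.
    by apply/sub_kermxP; rewrite -hE eq_row_base.
  by rewrite mulmxBr mul_mx_scalar => /eqP; rewrite subr_eq0 => /eqP.
have /submxP[T2 BT] : (B *m T <= B)%MS.
  rewrite /B eq_row_base; apply: submx_trans (submxMr _ _) (_ : (G *m T <= G)%MS).
    by rewrite eq_row_base.
  exact: comm_mx_stable_kermxpoly.
have ch := char_poly_direct_sum rEG full AT BT.
(* An eigenvector v of T2 for a would give w = v B in ker g(T) with w g(T) = g(a) w, hence w = 0,
   although the rows of B are free. *)
have nT2 : ~~ root (char_poly T2) a.
  rewrite -eigenvalue_root_char; apply/negP => /eigenvalueP[v vT2 v0].
  have vBT : (v *m B) *m T = a *: (v *m B) by rewrite -mulmxA BT mulmxA vT2 scalemxAl.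
  have vBg p : (v *m B) *m horner_mx T p = p.[a] *: (v *m B).
    elim/poly_ind: p => [|p b IH]; first by rewrite rmorph0 mulmx0 horner0 scale0r.
    rewrite rmorphD rmorphM /= horner_mx_X horner_mx_C mulmxDr mulmxA IH.
    rewrite -scalemxAl vBT mul_mx_scalar !hornerE scalerDl scalerA //.
  have : v *m B *m horner_mx T g = 0.
    apply/sub_kermxP; apply: submx_trans (submxMl _ _) _.
    by rewrite eq_row_base.
  rewrite vBg => /eqP; rewrite scaler_eq0 -/(root _ _) (negPf ga) /= => /eqP vB0.
  case/negP: v0; apply/eqP; apply: (row_free_inj (row_base_free G)).
  by rewrite vB0 mul0mx.
have sE : s = \rank E.
  apply: (@expX_factor_uniq a (c *: g ^+ s) (char_poly T2)) => //.
    by rewrite rootZ // rootE horner_exp expf_neq0.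
  by rewrite -ch chT -scalerAr exprMn.
rewrite sE; split; last exact: rank_leq_row.
have := mxrank_ker (T - a%:M); rewrite -hE -/E => ->.
by rewrite subKn // rank_leq_row.
Qed.
End SimpleEigenvalue.

(** * The Sylvester determinant as a characteristic polynomial *)

Lemma det_reindex (R : comNzRingType) N N' (G : nat -> nat -> R) (s t : nat -> nat) :
  N' = N -> (forall i, i < N -> s i < N)%N -> (forall i, i < N -> t i < N)%N ->
  {in (fun i => i < N)%N &, injective s} -> {in (fun i => i < N)%N &, injective t} ->
  exists b : bool, \det (\matrix_(i < N', j < N') G (s i) (t j)) =
                   (-1) ^+ b * \det (\matrix_(i < N, j < N) G i j).
Proof.
move=> -> {N'} ltS ltT injS injT.
pose f (i : 'I_N) := Ordinal (ltS i (ltn_ord i)).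
pose g (i : 'I_N) := Ordinal (ltT i (ltn_ord i)).
have injf : injective f.
  by move=> i j [] /injS => E; apply/val_inj/E; rewrite ?unfold_in /= ltn_ord.
have injg : injective g.
  by move=> i j [] /injT => E; apply/val_inj/E; rewrite ?unfold_in /= ltn_ord.
pose u := perm injf; pose v := perm injg.
exists (odd_perm u (+) odd_perm v).
have -> : \matrix_(i < N, j < N) G (s i) (t j) =
          row_perm u (col_perm v (\matrix_(i < N, j < N) G i j)).
  by apply/matrixP => i j; rewrite !mxE !permE.
rewrite row_permE col_permE !det_mulmx !det_perm signr_addb odd_permV.
by rewrite -mulrA [\det _ * _]mulrC.
Qed.

Lemma signr_scale (K : fieldType) (b : bool) (p : {poly K}) :
  (-1) ^+ b *: p = (-1) ^+ b * p.
Proof. by case: b; rewrite ?expr1 ?scaleN1r ?mulN1r // scale1r mul1r. Qed.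

Section ResultantCharPoly.
Variables (K : fieldType) (d : derivation K).
Local Notation D := (diffop d).
Variables (n m : nat) (P B : D).
Hypotheses (sP : size P = n.+1) (sB : size B = m.+1).

Local Notation cP :=
  (fun j e : nat => ((partial d j * P)`_e)%:P : {poly K}).
Local Notation cB :=
  (fun j e : nat =>
     ((partial d j * B)`_e)%:P - (if e == j then 'X else 0) : {poly K}).

(* Rows ∂^j P, then ∂^j (B - X); columns ∂^n, ..., ∂^(n+m-1), then 1, ..., ∂^(n-1) *)
Let G (r c : nat) : {poly K} :=
  let e := if (c < m)%N then (n + c)%N else (c - m)%N in
  if (r < m)%N then cP r e else cB (r - m)%N e.

(** Dividing ∂^i B by P writes each lower row as a combination of the rows ∂^j P plus a remainder,
    which is row i of [opmx n P B]. So the matrix is a unipotent factor times a block triangular one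
    with diagonal blocks [PH] and [opmx n P B] - X, and [PH] is triangular with [lead_coef P] on its
    diagonal. *)
Lemma det_sylvester_block :
  \det (\matrix_(i < m + n, j < m + n) G i j) =
  (lead_coef P ^+ m * (-1) ^+ n) *: char_poly (opmx n P B).
Proof.
have P0 : P != 0 by rewrite -size_poly_gt0 sP.
have B0 : B != 0 by rewrite -size_poly_gt0 sB.
pose PH : 'M[{poly K}]_m := \matrix_(j, e) cP j (n + e).
pose PL : 'M[{poly K}]_(m, n) := \matrix_(j, e) cP j e.
pose C : 'M[{poly K}]_(n, m) := \matrix_(i, j) ((dquo P (partial d i * B))`_j)%:P.
pose T := map_mx polyC (opmx n P B) - 'X%:M.
have quo_coef (i : 'I_n) e : (partial d i * B)`_e =
    \sum_(j < m) (dquo P (partial d i * B))`_j * (partial d j * P)`_e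
    + (drem P (partial d i * B))`_e.
  have [Q0|Q0] := eqVneq (dquo P (partial d i * B)) 0.
    rewrite {1}(ddivE P (partial d i * B)) Q0 mul0r add0r big1 ?add0r // => j _.
    by rewrite coef0 mul0r.
  (* For i < n the order of ∂^i B is at most n + m - 1, so the quotient has order below m and the m
     rows ∂^j P are enough. *)
  have sQ : (size (dquo P (partial d i * B)%R) <= m)%N.
    have := size_diffop_mul Q0 P0.
    have -> : dquo P (partial d i * B) * P = partial d i * B - drem P (partial d i * B).
      by rewrite {2}(ddivE P (partial d i * B)) addrK.
    have s1 : size (partial d i * B) = (i + m).+1.
      by rewrite size_diffop_mul ?partial_neq0 // size_partial sB addnS.
    have := size_drem (partial d i * B) P0; rewrite sP => s2 s3.
    have := size_polyD (partial d i * B) (- drem P (partial d i * B)).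
    rewrite s3 size_polyN s1 => le; have := ltn_ord i.
    have : (0 < size (dquo P (partial d i * B)%R))%N by rewrite size_poly_gt0.
    move: (size (dquo _ _)) (size (drem _ _)) le s2 => x y.
    by rewrite leq_max => /orP; lia.
  rewrite {1}(ddivE P (partial d i * B)) coefD; congr (_ + _).
  rewrite {1}(diffop_sum_coef sQ) mulr_suml coef_sum; apply: eq_bigr => j _.
  by rewrite -scalerAl coefZ.
have -> : \matrix_(i < m + n, j < m + n) G i j =
    block_mx 1%:M 0 C 1%:M *m block_mx PH PL 0 T.
  rewrite mulmx_block !mul1mx !mul0mx ?addr0 ?mulmx0 ?addr0.
  apply/matrixP => r c; rewrite mxE.
  case: (split_ordP r) => i ->; case: (split_ordP c) => j ->;
    rewrite ?(block_mxEul, block_mxEur, block_mxEdl, block_mxEdr) /G /=.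
  - by rewrite !ltn_ord mxE.
  - by rewrite ltn_ord ltnNge leq_addr /= addKn mxE.
  - rewrite ltn_ord ltnNge leq_addr /= addKn quo_coef mxE.
    rewrite (_ : (n + j == i)%N = false) ?subr0; last first.
      by apply/eqP; have := ltn_ord i; lia.
    rewrite [(drem _ _)`_ _]nth_default ?addr0; last first.
      have := size_drem (partial d i * B) P0; rewrite sP ltnS => /leq_trans.
      by apply; apply: leq_addr.
    by rewrite rmorph_sum /=; apply: eq_bigr => k _; rewrite !mxE polyCM.
  - rewrite ltnNge leq_addr /= ltnNge leq_addr /= !addKn quo_coef !mxE.
    rewrite polyCD -addrA; congr (_ + _).
      by rewrite rmorph_sum /=; apply: eq_bigr => k _; rewrite !mxE polyCM.
    by rewrite eq_sym; congr (_ - _); rewrite mulrb.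
rewrite det_mulmx det_lblock det_ublock !det1 !mul1r.
have -> : \det T = (-1) ^+ n * char_poly (opmx n P B).
  by rewrite /T -opprB -scaleN1r detZ.
rewrite -mul_polyC polyCM mulrA; congr (_ * _).
rewrite rmorphXn rmorphXn /= polyCN polyC1; congr (_ * _).
rewrite det_trig; last first.
  apply/is_trig_mxP => i j lt; rewrite mxE nth_default ?polyC0 //.
  by rewrite size_diffop_mul ?partial_neq0 // size_partial sP; lia.
rewrite (eq_bigr (fun=> (lead_coef P)%:P)) ?prodr_const ?card_ord // => i _.
rewrite mxE; congr (_%:P).
have [s l] := diffop_mul_lead (partial_neq0 d i) P0.
rewrite size_partial sP in s.
have := l; rewrite [lead_coef (partial d i)]lead_coefXn mul1r => <-.
by rewrite /lead_coef s; congr (_`_ _); lia.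
Qed.

Lemma sylvester_char_poly : exists2 c : K, c != 0 &
  \det (\matrix_(a < n + m - 2 * 0, b < n + m - 2 * 0)
          Sent n m 0 cP cB a (n + m - 1 - 0 - b)%N) = c *: char_poly (opmx n P B).
Proof.
(* S_0 lists powers of ∂ in decreasing order. [s] reverses each block of rows; [t] sends the columns
   of exponent at least n to the first m places of [G] and the others after them. *)
pose s a := if (a < m)%N then (m - 1 - a)%N else (m + (n - 1 - (a - m)))%N.
pose t c := if (n <= n + m - 1 - c)%N then (n + m - 1 - c - n)%N
            else (m + (n + m - 1 - c))%N.
have [|||||b E] := @det_reindex {poly K} (m + n) (n + m - 2 * 0) G s t.
- by lia.
- by rewrite /s => i; case: ifP; lia.
- by rewrite /t => i; case: ifP; lia.
- by rewrite /s => i j; rewrite !unfold_in; do 2!case: ifP; lia.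
- by rewrite /t => i j; rewrite !unfold_in; do 2!case: ifP; lia.
exists ((-1) ^+ b * (lead_coef P ^+ m * (-1) ^+ n)).
  by rewrite !mulf_neq0 ?expf_neq0 ?oppr_eq0 ?oner_eq0 ?lead_coef_eq0 // -size_poly_gt0 sP.
rewrite -scalerA -det_sylvester_block signr_scale -E; congr (\det _).
apply/matrixP => i j; rewrite !mxE /Sent /G subn0.
have ti : (if (t j < m)%N then (n + t j)%N else (t j - m)%N) = (n + m - 1 - 0 - j)%N.
  by rewrite /t; have := ltn_ord j; do 2!case: ifP; lia.
rewrite ti; have [lt|le] := ltnP i m.
  have -> : s i = (m - 1 - 0 - i)%N by rewrite /s lt subn0.
  by have -> : (m - 1 - 0 - i < m)%N by lia.
have -> : s i = (m + (n - 1 - 0 - (i - m)))%N by rewrite /s ltnNge le subn0.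
by rewrite ltnNge leq_addr addKn.
Qed.

(** The same elimination with the operator carrying the indeterminate listed first. It serves to
    read f(λ, a) as the characteristic polynomial of right multiplication by L on D / D(M - a). *)
Lemma sylvester_char_poly_swap : exists2 c : K, c != 0 &
  \det (\matrix_(a < m + n - 2 * 0, b < m + n - 2 * 0)
          Sent m n 0 cB cP a (m + n - 1 - 0 - b)%N) = c *: char_poly (opmx n P B).
Proof.
pose s a := if (a < n)%N then (m + (n - 1 - a))%N else (m - 1 - (a - n))%N.
pose t c := if (n <= n + m - 1 - c)%N then (n + m - 1 - c - n)%N
            else (m + (n + m - 1 - c))%N.
have [|||||b E] := @det_reindex {poly K} (m + n) (m + n - 2 * 0) G s t.
- by lia.
- by rewrite /s => i; case: ifP; lia.
- by rewrite /t => i; case: ifP; lia.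
- by rewrite /s => i j; rewrite !unfold_in; do 2!case: ifP; lia.
- by rewrite /t => i j; rewrite !unfold_in; do 2!case: ifP; lia.
exists ((-1) ^+ b * (lead_coef P ^+ m * (-1) ^+ n)).
  by rewrite !mulf_neq0 ?expf_neq0 ?oppr_eq0 ?oner_eq0 ?lead_coef_eq0 // -size_poly_gt0 sP.
rewrite -scalerA -det_sylvester_block signr_scale -E; congr (\det _).
apply/matrixP => i j; rewrite !mxE /Sent /G subn0.
have ti : (if (t j < m)%N then (n + t j)%N else (t j - m)%N) = (m + n - 1 - 0 - j)%N.
  by rewrite /t; have := ltn_ord j; do 2!case: ifP; lia.
rewrite ti; have [lt|le] := ltnP i n.
  have -> : s i = (m + (n - 1 - 0 - i))%N by rewrite /s lt subn0.
  by rewrite ltnNge leq_addr addKn.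
have -> : s i = (m - 1 - 0 - (i - n))%N by rewrite /s ltnNge le subn0.
by have -> : (m - 1 - 0 - (i - n) < m)%N by have := ltn_ord i; lia.
Qed.
End ResultantCharPoly.

(** * Polynomials in a commuting pair, and their action on D / D(L - l) *)

Section CommutingPair.
Variables (K : fieldType) (d : derivation K).
Variables (F : fieldType) (iota : {rmorphism F -> K}).
Hypothesis der_iota : forall c, d (iota c) = 0.
Local Notation D := (diffop d).
Implicit Types (X Y L M : D).

Lemma mul_scale_const X Y (c : F) : X * (iota c *: Y) = iota c *: (X * Y).
Proof.
rewrite [LHS]/(diffop_mul d X (iota c *: Y)) /diffop_mul.
rewrite [X * Y]/(diffop_mul d X Y) /diffop_mul scaler_sumr.
apply: eq_bigr => i _; rewrite [RHS]scalerA [iota c * _]mulrC -[RHS]scalerA; congr (_ *: _).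
elim: (i : nat) => [//|k IH]; rewrite !iterS IH ddmulZ.
by rewrite der_iota scale0r add0r.
Qed.

Definition constD (c : F) : D := (iota c)%:P.

Lemma constDE c : constD c = iota c *: (1 : D).
Proof. by rewrite /constD -[LHS]alg_polyC. Qed.

Lemma mul_constD X c : X * constD c = iota c *: X.
Proof. by rewrite constDE mul_scale_const mulr1. Qed.

Lemma constD_is_zmod_morphism : zmod_morphism constD.
Proof. by move=> a b; rewrite !constDE rmorphB scalerBl. Qed.
Lemma constD_is_monoid_morphism : monoid_morphism constD.
Proof.
split=> [|a b]; first by rewrite constDE rmorph1 scale1r.
by rewrite mul_constD !constDE scalerA rmorphM mulrC.
Qed.
HB.instance Definition _ :=
  GRing.isZmodMorphism.Build F D constD constD_is_zmod_morphism.
HB.instance Definition _ :=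
  GRing.isMonoidMorphism.Build F D constD constD_is_monoid_morphism.

Lemma constD_comm X c : GRing.comm X (constD c).
Proof. by rewrite /GRing.comm mul_constD constDE -scalerAl mul1r. Qed.

Definition eval1D L : {poly F} -> D := horner_morph (fun c => constD_comm L c).
HB.instance Definition _ L := GRing.RMorphism.on (eval1D L).

Lemma eval1DX L : eval1D L 'X = L. Proof. exact: horner_morphX. Qed.
Lemma eval1DC L c : eval1D L c%:P = constD c. Proof. exact: horner_morphC. Qed.

Lemma eval1D_comm L X : GRing.comm X L -> forall p, GRing.comm X (eval1D L p).
Proof.
move=> cXL p; elim/poly_ind: p => [|p c IH]; first by rewrite rmorph0; apply: commr0.
rewrite rmorphD rmorphM /= eval1DX eval1DC.
by apply: commrD; [apply: commrM|apply: constD_comm].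
Qed.

(** The outer variable μ goes to M, the inner λ to L. The commutation proof is an argument because
    evaluation is multiplicative only at a value commuting with the coefficients. *)
Definition eval2D L M (cML : GRing.comm M L) : {poly {poly F}} -> D :=
  horner_morph (eval1D_comm cML).
HB.instance Definition _ L M (cML : GRing.comm M L) := GRing.RMorphism.on (eval2D cML).

Section Eval2.
Variables (L M : D) (cML : GRing.comm M L).
Lemma eval2DX : eval2D cML 'X = M. Proof. exact: horner_morphX. Qed.
Lemma eval2DC p : eval2D cML p%:P = eval1D L p. Proof. exact: horner_morphC. Qed.
End Eval2.

Section Specialization.
Variables (n' : nat) (L M : D) (cML : GRing.comm M L).
Local Notation n := n'.+1.
Hypotheses (sL : size L = n.+1).

Definition spec (l : F) (H : {poly {poly F}}) : {poly F} := map_poly (horner_eval l) H.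

Lemma size_sub_const l : size (L - constD l) = n.+1.
Proof.
rewrite size_polyDl sL // size_polyN; apply: leq_ltn_trans (size_polyC_leq1 _) _.
by [].
Qed.

Lemma comm_sub_const l : (L - constD l) * M = M * (L - constD l).
Proof. by rewrite mulrBl mulrBr -cML constD_comm. Qed.

Lemma remrow_eval1D l X p :
  remrow n (L - constD l) (X * eval1D L p) =
  iota p.[l] *: remrow n (L - constD l) X.
Proof.
have sP := size_sub_const l.
elim/poly_ind: p => [|p c IH] in X *.
  by rewrite rmorph0 mulr0 horner0 rmorph0 scale0r (remrow0 sP).
rewrite rmorphD rmorphM /= eval1DX eval1DC mulrDr mul_constD remrowD //.
rewrite remrowZ // mulrA.
have EL Y : Y * L = Y * (L - constD l) + iota l *: Y.
  by rewrite -mul_constD -mulrDr subrK.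
rewrite [_ * L]EL remrowD // remrow_mulP // add0r remrowZ // IH.
by rewrite !hornerE rmorphD rmorphM scalerDl scalerA mulrC.
Qed.

(** Modulo D(L - l), right multiplication by L is the scalar l and by M the matrix T, so H(L, M)
    acts as H(l, T). *)
Lemma remrow_eval2D l X H :
  remrow n (L - constD l) (X * eval2D cML H) =
  remrow n (L - constD l) X *m
    horner_mx (opmx n (L - constD l) M) (map_poly iota (spec l H)).
Proof.
have sP := size_sub_const l.
elim/poly_ind: H => [|H p IH] in X *.
  by rewrite /spec !rmorph0 mulr0 mulmx0 (remrow0 sP).
rewrite rmorphD rmorphM /= eval2DX eval2DC mulrDr mulrA remrowD //.
rewrite remrow_mul ?comm_sub_const // IH remrow_eval1D.
rewrite /spec !rmorphD !rmorphM /= !map_polyX !map_polyC /= horner_mx_X horner_mx_C.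
by rewrite mulmxDr mulmxA mul_mx_scalar.
Qed.

Hypothesis charF0 : [pchar F] =i pred0.

(** Taking l = 0, 1, 2, ... shows that X is a left multiple of the product of the L - i for i < k,
    whose order k n exceeds that of X once k is large. *)
Lemma in_all_left_ideals_eq0 X :
  (forall l, remrow n (L - constD l) X = 0) -> X = 0.
Proof.
move=> rX; pose p k : {poly F} := \prod_(i < k) ('X - (i%:R)%:P).
have E k : exists C, X = C * eval1D L (p k).
  elim: k => [|k [C EC]]; first by exists X; rewrite /p big_ord0 rmorph1 mulr1.
  (* At l = k the remainder of X = C p_k(L) is p_k(k) times that of C. In characteristic 0 the value
     p_k(k) is nonzero, so C lies in D(L - k). *)
  have := rX k%:R; rewrite EC remrow_eval1D => /eqP.
  rewrite scaler_eq0 fmorph_eq0 /p horner_prod prodf_seq_eq0 /=.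
  case/orP=> [/hasP[i _]|/eqP/(remrow_eq0 (size_sub_const _))[C' EC']].
    rewrite !hornerE subr_eq0 /= => /eqP ki; exfalso.
    have : (k - i)%:R == 0 :> F by rewrite natrB ?ki ?subrr // ltnW.
    by rewrite (pcharf0P F).1 // subn_eq0 leqNgt ltn_ord.
  exists C'; rewrite EC' -mulrA; congr (_ * _).
  rewrite [\prod_(i < k.+1) _]big_ord_recr [X in _ = eval1D L X]mulrC rmorphM; congr (_ * _) => /=.
  by rewrite rmorphB /= eval1DX eval1DC.
have szp k : size (eval1D L (p k)) = (k * n).+1.
  elim: k => [|k IH]; first by rewrite /p big_ord0 rmorph1 size_poly1.
  rewrite /p big_ord_recr rmorphM /= rmorphB /= eval1DX eval1DC -/(p k).
  rewrite size_diffop_mul -?size_poly_gt0 ?IH ?size_sub_const //.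
  by rewrite mulSn; lia.
apply/eqP; apply: contraT => X0; have [C EC] := E (size X).
have C0 : C != 0 by apply: contraNneq X0 => C0; rewrite EC C0 mul0r.
have e0 : eval1D L (p (size X)) != 0 by rewrite -size_poly_gt0 szp.
have := size_diffop_mul C0 e0; rewrite -EC szp.
have : (0 < size C)%N by rewrite size_poly_gt0.
by move: (size C) (size X) => a b; nia.
Qed.

(** The form in which the resultant enters the argument, kept abstract so that it applies both to L,
    M, f and to M, L, [swapXY f]. *)
Definition char_curve (f : {poly {poly F}}) := forall l, exists2 c : K, c != 0 &
  map_poly iota (spec l f) = c *: char_poly (opmx n (L - constD l) M).

Lemma char_curve_vanish f : char_curve f -> eval2D cML f = 0.
Proof.
move=> cf; apply: in_all_left_ideals_eq0 => l.
rewrite -[eval2D _ _]mul1r remrow_eval2D; have [c _ ->] := cf l.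
by rewrite linearZ /= Cayley_Hamilton scaler0 mulmx0.
Qed.

Lemma char_curve_degree h s l : char_curve (h ^+ s) -> n = (s * (size (spec l h)).-1)%N.
Proof.
move=> cf; have [c c0] := cf l; rewrite /spec !rmorphXn /=.
move/(congr1 (fun q : {poly K} => (size q).-1)).
by rewrite size_scale // size_char_poly size_exp mulnC size_map_poly.
Qed.

(** From h(L, M) = 0 follows h(l, T) = 0, where h(l, μ) has the simple root a and its power s is the
    characteristic polynomial of T up to a factor. *)
Lemma simple_point_rank h s l a : char_curve (h ^+ s) ->
  root (spec l h) a -> ~~ root (spec l h)^`() a ->
  \rank (opmx n (L - constD l) M - (iota a)%:M) = (n - s)%N /\ (s <= n)%N.
Proof.
move=> cf ra da; have h0 : eval2D cML h = 0.
  by apply: (@diffop_expf_eq0 _ _ _ s); rewrite -rmorphXn /= char_curve_vanish.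
have /factor_theorem[q hq] := ra.
have qa : ~~ root q a.
  apply: contra da; rewrite hq derivM !rootE !hornerE derivXsubC !hornerE subrr.
  by rewrite mulr0 add0r.
have [c c0 Ech] := cf l.
have Eh : map_poly iota (spec l h) = ('X - (iota a)%:P) * map_poly iota q.
  by rewrite hq rmorphM rmorphB /= map_polyX map_polyC mulrC.
apply: (@eigenspace_rank_simple_root _ _ _ _ c^-1 (map_poly iota q)).
- by rewrite invr_eq0.
- rewrite -Eh; set T := horner_mx _ _.
  have sP := size_sub_const l.
  apply/row_matrixP => i; rewrite row0 rowE.
  (* The i-th basis vector is the class of ∂^i, so row i of h(l, T) is the class of ∂^i h(L, M) =
     0. *)
  have -> : delta_mx 0 i = remrow n (L - constD l) (partial d i).
    rewrite (remrow_small sP) ?size_partial //; apply/rowP => j.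
    by rewrite !mxE /partial coefXn eqxx.
  by rewrite -remrow_eval2D h0 mulr0 remrow0.
- by rewrite fmorph_root.
- by rewrite -Eh -rmorphXn /= /spec -rmorphXn /= -/(spec l _) Ech scalerA mulVf ?scale1r.
Qed.

(** Modulo DP, left multiples of U P + V Q fall in the image of T - a, of rank n - s. If U P + V Q =
    0, left multiples of V fall in its kernel, of rank s. [left_ideal_rank] turns both ranks into
    lower bounds on orders. *)
Lemma simple_point_ideal h s l a : char_curve (h ^+ s) ->
  root (spec l h) a -> ~~ root (spec l h)^`() a ->
  let P := L - constD l in let Q := M - constD a in
  (forall U V, U * P + V * Q != 0 -> (s < size (U * P + V * Q)%R)%N) /\
  (forall U V, U * P + V * Q = 0 -> (size V <= n - s)%N -> U = 0 /\ V = 0).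
Proof.
move=> cf ra da P Q; have [rk les] := simple_point_rank cf ra da.
have sP : size P = n.+1 := size_sub_const l.
have cPQ : P * Q = Q * P.
  by rewrite /Q mulrBr [RHS]mulrBl (comm_sub_const l) (constD_comm P a).
have TQ X : remrow n P (X * Q) = remrow n P X *m (opmx n P M - (iota a)%:M).
  rewrite mulrBr mul_constD remrowB // remrowZ // remrow_mul ?comm_sub_const //.
  by rewrite mulmxBr mul_mx_scalar.
split=> U V.
  set X := U * P + V * Q => X0.
  have [leX|/(leq_ltn_trans les)//] := leqP (size X) n.
  have := left_ideal_rank sP X0 leX (W := opmx n P M - (iota a)%:M).
  rewrite rk => W; suff : (n < n - s + size X)%N by lia.
  apply: W => j; rewrite /X mulrDr !mulrA remrowD // remrow_mulP // add0r TQ.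
  exact: submxMl.
move=> E leV; suff V0 : V = 0.
  move/eqP: E; rewrite V0 mul0r addr0 diffop_mul_eq0 -[P == 0]negbK.
  by rewrite -size_poly_gt0 sP orbF => /eqP.
apply/eqP; apply: contraT => V0.
have leVn : (size V <= n)%N by apply: leq_trans leV (leq_subr _ _).
have := left_ideal_rank sP V0 leVn (W := kermx (opmx n P M - (iota a)%:M)).
rewrite mxrank_ker rk subKn // => W; suff : (n < s + size V)%N by lia.
apply: W => j; apply/sub_kermxP; rewrite -TQ.
have -> : partial d j * V * Q = - (partial d j * U) * P.
  by apply/eqP; rewrite mulNr -addr_eq0 -!mulrA -mulrDr addrC E mulr0.
exact: remrow_mulP.
Qed.
End Specialization.
End CommutingPair.

(** * Leading coefficients of commuting operators *)

Section LeadingCoefficients.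
Variables (K : fieldType) (d : derivation K).
Local Notation D := (diffop d).

Lemma coef_ddmulS (Q : {poly K}) k : (ddmul d Q)`_k.+1 = d Q`_k.+1 + Q`_k.
Proof. by rewrite /ddmul coefD coef_map_id0 ?raddf0 // coefXM. Qed.

Lemma size_iter_ddmul i q (Q : {poly K}) : (size Q <= q)%N ->
  (size (iter i (ddmul d) Q) <= i + q)%N.
Proof.
move=> leQ; have [->|Q0] := eqVneq Q 0.
  rewrite (_ : iter i _ 0 = 0) ?size_poly0 //.
  by elim: i => // i IH; rewrite iterS IH raddf0.
by rewrite (iter_ddmul_lead d i Q0).1 leq_add2l.
Qed.

Lemma iter_ddmul_coef_top i q (Q : {poly K}) : (size Q <= q.+1)%N ->
  (iter i (ddmul d) Q)`_(i + q) = Q`_q.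
Proof.
move=> leQ; elim: i => [//|i IH]; rewrite iterS addSn coef_ddmulS IH.
rewrite nth_default ?raddf0 ?add0r //.
by rewrite -addnS size_iter_ddmul.
Qed.

Lemma iter_ddmul_coef_sub i q (Q : {poly K}) : (size Q <= q.+1)%N ->
  (iter i.+1 (ddmul d) Q)`_(i + q) = ('X * Q)`_q + i.+1%:R * d Q`_q.
Proof.
move=> leQ; elim: i => [|i IH].
  by rewrite mul1r /= /ddmul coefD coef_map_id0 ?raddf0 // addrC.
rewrite iterS addSn coef_ddmulS -addSn iter_ddmul_coef_top // IH.
by rewrite -[in RHS]natr1 mulrDl mul1r [LHS]addrC addrA.
Qed.

Lemma diffop_mul_coef_sub (P Q : D) p q k : (size P <= p.+1)%N -> (size Q <= q.+1)%N ->
  k.+1 = (p + q)%N ->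
  (P * Q)`_k = P`_p * (('X * (Q : {poly K}))`_q + p%:R * d Q`_q)
               + ('X * (P : {poly K}))`_p * Q`_q.
Proof.
move=> leP leQ.
have -> : P * Q = \sum_(i < p.+1) P`_i *: iter i (ddmul d) Q := diffop_mulE d Q leP.
rewrite coef_sum.
case: p leP => [|p] leP Ek.
  rewrite add0n in Ek; rewrite big_ord1 coefZ /= mul0r addr0 !coefXM /= mul0r addr0.
  by rewrite -Ek.
have {Ek} -> : k = (p + q)%N by lia.
rewrite !big_ord_recr /= big1 ?add0r; last first.
  move=> i _; have le : (i + q.+1 <= p + q)%N by have := ltn_ord i; lia.
  have z := nth_default 0 (leq_trans (size_iter_ddmul i leQ) le).
  by rewrite coefZ z mulr0.
rewrite !coefZ iter_ddmul_coef_top // -/(iter p.+1 (ddmul d) Q) iter_ddmul_coef_sub //.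
by rewrite addrC; congr (_ + _); rewrite coefXM.
Qed.

(** Compare the coefficients of ∂^(p+q-1) in P Q and Q P: the terms without derivatives are
    symmetric and cancel. *)
Lemma comm_lead_coef (P Q : D) p q : (size P <= p.+1)%N -> (size Q <= q.+1)%N ->
  (0 < p + q)%N -> P * Q = Q * P ->
  p%:R * P`_p * d Q`_q = q%:R * Q`_q * d P`_p.
Proof.
move=> leP leQ pq E; pose k := (p + q).-1.
have := congr1 (fun X : {poly K} => X`_k) E.
have Ek : k.+1 = (p + q)%N by rewrite prednK.
rewrite (diffop_mul_coef_sub leP leQ Ek); rewrite addnC in Ek.
rewrite (diffop_mul_coef_sub leQ leP Ek).
move: (('X * (P : {poly K}))`_p) (('X * (Q : {poly K}))`_q) => u v.
move: (d Q`_q) (d P`_p) P`_p Q`_q => dQ dP a b /eqP; rewrite -subr_eq0 => /eqP EE.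
apply/eqP; rewrite -subr_eq0; apply/eqP; rewrite -EE; ring.
Qed.

Variables (F : fieldType) (iota : {rmorphism F -> K}).
Hypothesis der_eq0 : forall u, d u = 0 -> exists c, u = iota c.
Hypothesis charK0 : [pchar K] =i pred0.

(** Both leading coefficients solve the same equation N a l' = n l a', with l that of L, so their
    quotient has derivative 0. *)
Lemma comm_lead_ratio (L A B : D) : (1 < size L)%N -> B != 0 -> size A = size B ->
  A * L = L * A -> B * L = L * B ->
  exists c, lead_coef A = iota c * lead_coef B.
Proof.
move=> sL B0 sAB cA cB.
have sB : (0 < size B)%N by rewrite size_poly_gt0.
pose n := (size L).-1; pose N := (size B).-1.
have leL : (size L <= n.+1)%N by rewrite /n prednK // ltnW.
have leB : (size B <= N.+1)%N by rewrite /N prednK.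
have leA : (size A <= N.+1)%N by rewrite sAB.
have n0 : (0 < N + n)%N by rewrite /n; lia.
have EA := comm_lead_coef leA leL n0 cA.
have EB := comm_lead_coef leB leL n0 cB.
have b0 : lead_coef B != 0 by rewrite lead_coef_eq0.
have l0 : n%:R * L`_n != 0.
  rewrite mulf_neq0 ?(pcharf0P K).1 //; first by rewrite /n; lia.
  by rewrite -[L`_n]/(lead_coef L) lead_coef_eq0 -size_poly_gt0 ltnW.
have aE : A`_N = lead_coef A by rewrite /lead_coef sAB.
have bE : B`_N = lead_coef B by [].
rewrite aE bE in EA EB.
have [u au] : exists u, lead_coef A = u * lead_coef B.
  by exists (lead_coef A / lead_coef B); rewrite mulfVK.
have [|c uc] := @der_eq0 u; last by exists c; rewrite -uc.
apply/eqP; have : (n%:R * L`_n) * (d u * lead_coef B) == 0.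
  have -> : d u * lead_coef B = d (lead_coef A) - u * d (lead_coef B).
    by rewrite au derM addrK.
  by rewrite mulrBr -EA [X in _ - X]mulrCA -EB au subr_eq0; apply/eqP; ring.
by rewrite !mulf_eq0 -mulf_eq0 (negPf l0) (negPf b0) orbF.
Qed.

(* Gaussian elimination on leading coefficients *)
Lemma linear_dependence (S : D -> Prop) (r : nat) : (0 < r)%N ->
  (forall x y c, S x -> S y -> S (x - iota c *: y)) ->
  (forall x, S x -> (r %| (size x).-1)%N) ->
  (forall x y, S x -> S y -> y != 0 -> size x = size y ->
     exists c, lead_coef x = iota c * lead_coef y) ->
  forall k N (g : 'I_N -> D), (k < N)%N -> (forall i, S (g i)) ->
  (forall i, size (g i) <= r * k)%N ->
  exists2 c : 'I_N -> F, (exists i, c i != 0) & \sum_i iota (c i) *: g i = 0.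
Proof.
move=> r0 Sub Sr Slead; elim=> [|k IH] N g ltN Sg leg.
  exists (fun=> 1); first by exists (Ordinal ltN); rewrite oner_eq0.
  apply: big1 => i _; have := leg i.
  by rewrite muln0 leqn0 size_poly_eq0 => /eqP ->; rewrite scaler0.
(* Orders in [S] are multiples of r, so between the bounds r k and r (k + 1) only the size r k + 1
   can occur: one pivot [g i0] suffices to lower all the other operators. *)
have Sk x : S x -> (size x <= r * k.+1)%N -> (size x <= r * k)%N \/ size x = (r * k).+1.
  move=> /Sr/dvdnP[t]; case: (size x) => [|z] /=; first by left.
  move=> ->; rewrite [(r * k.+1)%N]mulnC ltn_mul2r r0 /= ltnS => letk.
  have [tk|tk] := ltnP t k; last by right; rewrite (_ : t = k) 1?mulnC //; lia.
  by left; rewrite [(r * k)%N]mulnC ltn_mul2r r0.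
have [/forallP al|] := boolP [forall i, size (g i) <= r * k]%N.
  by apply: IH => //; apply: ltnW.
rewrite negb_forall => /existsP[i0 big].
case: N g ltN Sg leg i0 big => [//|N] g ltN Sg leg i0 big.
have s0 : size (g i0) = (r * k).+1.
  by case: (Sk _ (Sg i0) (leg i0)) => // le; rewrite le in big.
have g0 : g i0 != 0 by rewrite -size_poly_gt0 s0.
have /fin_all_exists[e He] : forall j : 'I_N, exists c,
    (size (g (lift i0 j) - iota c *: g i0)%R <= r * k)%N.
  move=> j; case: (Sk _ (Sg (lift i0 j)) (leg (lift i0 j))) => [le|eqs].
    by exists 0; rewrite rmorph0 scale0r subr0.
  have [c Hc] := Slead _ _ (Sg (lift i0 j)) (Sg i0) g0 (etrans eqs (esym s0)).
  exists c; rewrite -ltnS -eqs.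
  have x0 : g (lift i0 j) != 0 by rewrite -size_poly_gt0 eqs.
  have c0 : iota c != 0.
    by apply: contraNneq x0 => c0; rewrite -lead_coef_eq0 Hc c0 mul0r.
  by apply: size_sub_same_lead; rewrite ?lead_coefZ // size_scale // eqs s0.
have [||f [j fj] Ef] := IH N (fun j => g (lift i0 j) - iota (e j) *: g i0) _ _ He.
- by [].
- by move=> j; apply: Sub.
(* Expanding the relation between the reduced operators gives the pivot this coefficient. *)
pose c i := if unlift i0 i is Some j then f j else - \sum_j f j * e j.
exists c; first by exists (lift i0 j); rewrite /c liftK.
rewrite (bigD1_ord i0) //= {1}/c unlift_none rmorphN rmorph_sum scaleNr scaler_suml.
apply/eqP; rewrite addrC subr_eq0 -subr_eq0 -sumrB -[X in _ == X]Ef; apply/eqP.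
apply: eq_bigr => i _; rewrite /c liftK scalerBr scalerA rmorphM //.
Qed.
End LeadingCoefficients.

(** * A Gauss lemma in F[λ][μ] *)

Section Gauss.
Variable F : closedFieldType.

Lemma spec_eq0 (l : F) (p : {poly {poly F}}) : spec l p = 0 ->
  exists2 p1, p = ('X - l%:P)%:P * p1 & size p1 = size p.
Proof.
move=> p0; pose x : {poly F} := 'X - l%:P; have x0 : x != 0 by rewrite polyXsubC_eq0.
pose p1 : {poly {poly F}} := map_poly (fun u => u %/ x) p.
have E : p = x%:P * p1.
  apply/polyP => i; rewrite coefCM coef_map_id0 ?div0p // mulrC divpK //.
  rewrite dvdp_XsubCl rootE; have /polyP/(_ i) := p0.
  by rewrite /spec coef_map coef0 /= /horner_eval => ->.
by exists p1 => //; rewrite [in RHS]E mul_polyC size_scale.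
Qed.

(** Remove the roots of c one at a time: if c(l) = 0, then q or g vanishes at λ = l and is divisible
    by λ - l, which cancels. The μ-degree of g is unaffected. *)
Lemma gauss_factor (c : {poly F}) (h q g : {poly {poly F}}) :
  c != 0 -> c%:P * h = q * g -> exists q1 g1, h = q1 * g1 /\ size g1 = size g.
Proof.
have [N] := ubnP (size c); elim: N => // N IH in c q g *; rewrite ltnS => lec c0 E.
have [/eqP/size_poly1P[k k0 ck]|sc] := eqVneq (size c) 1%N.
  exists ((k^-1)%:P%:P * q), g; split=> //; rewrite -mulrA -E mulrA ck.
  by rewrite -!polyCM mulVf // mul1r.
have [l /factor_theorem[c1 Ec]] := closed_rootP c sc.
have x0 : 'X - l%:P != 0 :> {poly F} by rewrite polyXsubC_eq0.
have c10 : c1 != 0 by apply: contraNneq c0 => c10; rewrite Ec c10 mul0r.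
have ltc : (size c1 < N)%N.
  by apply: leq_trans lec; rewrite Ec size_Mmonic ?monicXsubC // size_XsubC addn2.
have : spec l q * spec l g == 0.
  rewrite -rmorphM /= -E rmorphM /= map_polyC /= Ec /horner_eval hornerM !hornerE subrr.
  by rewrite mulr0 mul0r.
have X0 : ('X - l%:P)%:P != 0 :> {poly {poly F}} by rewrite polyC_eq0.
rewrite mulf_eq0 => /orP[/eqP/spec_eq0[q1 Eq _]|/eqP/spec_eq0[g1 Eg sg]].
  apply: (IH c1 q1 g ltc c10); apply: (mulfI X0).
  by rewrite mulrA -polyCM [_ * c1]mulrC -Ec E Eq mulrA.
have [q2 [g2 [Eh sg2]]] : exists q2 g2, h = q2 * g2 /\ size g2 = size g1.
  apply: (IH c1 q g1 ltc c10); apply: (mulfI X0).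
  by rewrite mulrA -polyCM [_ * c1]mulrC -Ec E Eg mulrCA.
by exists q2, g2; rewrite sg2.
Qed.
End Gauss.

(** * Bounding the degree in μ of the spectral curve *)

Lemma size_diffop_exp (K : fieldType) (d : derivation K) (P : diffop d) k :
  P != 0 -> size (P ^+ k) = ((size P).-1 * k).+1.
Proof.
move=> P0; elim: k => [|k IH]; first by rewrite expr0 size_poly1 muln0.
rewrite exprS size_diffop_mul // -?size_poly_gt0 IH //.
by move: P0; rewrite -size_poly_gt0; case: (size P) => // s _; rewrite mulnS /=; lia.
Qed.

Section SpectralDegree.
Variables (K : fieldType) (d : derivation K).
Variables (F : closedFieldType) (iota : {rmorphism F -> K}).
Hypothesis der_iota : forall c, d (iota c) = 0.
Hypothesis der_eq0 : forall u, d u = 0 -> exists c, u = iota c.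
Hypothesis charK0 : [pchar K] =i pred0.
Local Notation D := (diffop d).
Variables (n m r : nat) (L M : D) (cML : GRing.comm M L).
Hypotheses (sL : size L = n.+1) (sM : size M = m.+1) (n0 : (0 < n)%N) (r0 : (0 < r)%N).
Hypotheses (rn : (r %| n)%N) (rm : (r %| m)%N).
Local Notation ev := (eval2D der_iota cML).
Hypothesis rank_dvd : forall H, (r %| (size (ev H)).-1)%N.

Lemma eval2D_commL H : ev H * L = L * ev H.
Proof.
elim/poly_ind: H => [|H p IH]; first by rewrite rmorph0 mul0r mulr0.
rewrite rmorphD rmorphM /= eval2DX eval2DC mulrDl mulrDr; congr (_ + _).
  by rewrite -mulrA cML !mulrA IH.
exact/esym/eval1D_comm.
Qed.

(** L is transcendental over F: p splits into linear factors, and each L - z is nonzero because L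
    has positive order. *)
Lemma eval1D_eq0 p : eval1D der_iota L p = 0 -> p = 0.
Proof.
have prod0 (s : seq F) : eval1D der_iota L (\prod_(z <- s) ('X - z%:P)) != 0.
  elim: s => [|z s IH]; first by rewrite big_nil rmorph1 oner_eq0.
  rewrite big_cons rmorphM /= diffop_mul_eq0 negb_or IH andbT.
  rewrite rmorphB /= eval1DX eval1DC -size_poly_eq0.
  by case: (n) sL n0 => // n1 sL1 _; rewrite (size_sub_const iota sL1).
have [s ->] := closed_field_poly_normal p.
rewrite -mul_polyC rmorphM /= eval1DC => /eqP.
rewrite diffop_mul_eq0 (negPf (prod0 s)) orbF /constD polyC_eq0 fmorph_eq0 => /eqP ->.
by rewrite mul0r.
Qed.

Lemma spectral_relation :
  exists2 H, H != 0 /\ ev H = 0 & (size H <= (n %/ r).+1)%N.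
Proof.
pose n1 := (n %/ r)%N; pose m1 := (m %/ r)%N.
have En : n = (n1 * r)%N by rewrite divnK.
have Em : m = (m1 * r)%N by rewrite divnK.
have n10 : (0 < n1)%N by move: n0; rewrite {1}En muln_gt0 => /andP[].
pose a := (n1 * m1).+1; pose T := ('I_a * 'I_n1.+1)%type.
have L0 : L != 0 by rewrite -size_poly_gt0 sL.
have M0 : M != 0 by rewrite -size_poly_gt0 sM.
pose mon (c : F) (k : 'I_#|{: T}|) : {poly {poly F}} :=
  (c *: 'X^((enum_val k).1)) *: 'X^((enum_val k).2).
have ev_mon c k : ev (mon c k) = iota c *: (L ^+ (enum_val k).1 * M ^+ (enum_val k).2).
  rewrite /mon -mul_polyC rmorphM /= eval2DC rmorphXn /= eval2DX.
  rewrite -mul_polyC rmorphM /= eval1DC rmorphXn /= eval1DX.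
  by rewrite constDE -!scalerAl mul1r.
pose S (x : D) := exists H, x = ev H.
(* The monomials have order at most r (k - 1), which leaves k possible orders 0, r, ..., r (k - 1).
   There are (n1 m1 + 1)(n1 + 1) = k + n1 monomials, more than k. *)
pose k := (n1 * m1 * n1 + n1 * m1).+1.
have [||||||c [k0 ck0] Ec] := @linear_dependence K d F iota S r r0 _ _ _ k #|{: T}|
    (fun k => ev (mon 1 k)).
- move=> x y c [H1 ->] [H2 ->]; exists (H1 - (c%:P)%:P * H2).
  by rewrite [RHS]raddfB /= [in RHS]rmorphM /= eval2DC eval1DC constDE -scalerAl mul1r.
- by move=> x [H ->].
- move=> x y [H1 ->] [H2 ->] y0 sxy.
  apply: (comm_lead_ratio der_eq0 charK0 (L := L)) => //; rewrite ?eval2D_commL //.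
  by rewrite sL ltnS.
- by rewrite card_prod !card_ord /k /a; nia.
- by move=> i; exists (mon 1 i).
- move=> i; rewrite ev_mon rmorph1 scale1r.
  rewrite size_diffop_mul -?size_poly_gt0 !size_diffop_exp // sL sM /=.
  have hx : (n * (enum_val i).1 <= n1 * r * (n1 * m1))%N.
    by rewrite -En leq_mul // -ltnS ltn_ord.
  have hy : (m * (enum_val i).2 <= m1 * r * n1)%N.
    by rewrite -Em leq_mul // -ltnS ltn_ord.
  rewrite /k.
  have -> : (r * (n1 * m1 * n1 + n1 * m1).+1 = n1 * r * (n1 * m1) + m1 * r * n1 + r)%N.
    by ring.
  by rewrite addnS -addn1 !leq_add.
exists (\sum_k mon (c k) k).
  split; last first.
    rewrite rmorph_sum /= -[RHS]Ec; apply: eq_bigr => i _.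
    by rewrite !ev_mon rmorph1 scale1r.
  apply: contraNneq ck0 => H0.
  have := congr1 (fun p : {poly {poly F}} => (p`_((enum_val k0).2))`_((enum_val k0).1)) H0.
  rewrite !coef0 !coef_sum (bigD1 k0) //= /mon !coefZ !coefXn !eqxx mulr1 coefZ coefXn eqxx.
  rewrite mulr1 big1 ?addr0 => [->//|i ik0].
  rewrite coefZ coefXn; case: eqP => [/val_inj e2|]; last by rewrite mulr0 coef0.
  rewrite mulr1 coefZ coefXn; case: eqP => [/val_inj e1|]; last by rewrite mulr0.
  case/eqP: ik0; apply: enum_val_inj.
  by rewrite [enum_val i]surjective_pairing -e1 -e2 -surjective_pairing.
apply: leq_trans (size_sum _ _ _) _; apply/bigmax_leqP => i _.
apply: leq_trans (size_scale_leq _ _) _; rewrite size_polyXn.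
exact: ltn_ord.
Qed.

(** Pseudo-divide h by H. A nonzero remainder also vanishes at (L, M) and is smaller, so induction
    applies. Otherwise c h = q H, and [gauss_factor] splits h with a factor of the μ-degree of H:
    either this is the degree of h, or H lies in F[λ], which [eval1D_eq0] excludes. *)
Lemma irreducible_size_le h H : irreducible2 h -> ev h = 0 ->
  H != 0 -> ev H = 0 -> (size h <= size H)%N.
Proof.
move=> [h0 [hu hirr]] evh; have [N] := ubnP (size H).
elim: N => // N IH in H *; rewrite ltnS => leH H0 evH.
have := Pdiv.Idomain.divp_eq h H.
set c := lead_coef H ^+ _ => E.
have c0 : c != 0 by rewrite expf_neq0 // lead_coef_eq0.
have [rem0|rem0] := eqVneq (h %% H) 0; last first.
  have ltr : (size (h %% H)%R < size H)%N by rewrite ltn_modp.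
  apply: leq_trans (ltnW ltr); apply: IH => //; first exact: leq_trans ltr leH.
  have := congr1 ev E; rewrite -mul_polyC !rmorphD !rmorphM /= evh evH !mulr0 add0r.
  by move/esym.
rewrite rem0 addr0 -mul_polyC in E.
have [q1 [g1 [Eh sg]]] := gauss_factor c0 E.
have [] := hirr _ _ Eh; rewrite poly_unitE => /andP[/eqP s1 u1].
  rewrite -sg Eh; have /eqP/size_poly1P[k k0 ->] := s1.
  by rewrite mul_polyC size_scale.
have sH : size H = 1%N by rewrite -sg.
have /eqP/size_poly1P[k k0 Hk] := sH.
by move: evH; rewrite Hk eval2DC => /eval1D_eq0 k00; rewrite k00 eqxx in k0.
Qed.

Lemma spectral_size_le h : irreducible2 h -> ev h = 0 -> (size h <= (n %/ r).+1)%N.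
Proof.
move=> hirr evh; have [H [H0 evH] leH] := spectral_relation.
exact: leq_trans (irreducible_size_le hirr evh H0 evH) leH.
Qed.
End SpectralDegree.

(** * Subresultants as elements of DP + DQ, and the order of the first nonzero one *)

Section Subresultants.
Variables (K : fieldType) (d : derivation K).
Local Notation D := (diffop d).
Variables (n m : nat) (P Q : D).
Hypotheses (sP : size P = n.+1) (sQ : size Q = m.+1).

Local Notation cP := (fun j e : nat => (partial d j * P)`_e).
Local Notation cQ := (fun j e : nat => (partial d j * Q)`_e).

Definition subresD k : D :=
  \sum_(i < k.+1) \det (Smx_i n m k cP cQ i) *: partial d i.

Lemma subresD_poly k :
  subresD k = \poly_(i < k.+1) \det (Smx_i n m k cP cQ i) :> {poly K}.
Proof. by rewrite poly_def. Qed.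

Definition sylvester_row k a : D :=
  if (a < m - k)%N then partial d (m - 1 - k - a) * P
  else partial d (n - 1 - k - (a - (m - k))) * Q.

Lemma Sent_row k a e : Sent n m k cP cQ a e = (sylvester_row k a)`_e.
Proof. by rewrite /Sent /sylvester_row; case: ifP. Qed.

Section Order.
Variable k : nat.
Hypotheses (kn : (k < n)%N) (km : (k < m)%N).

Lemma sylvester_row_comb (v : nat -> K) :
  \sum_(a < n + m - 2 * k) v a *: sylvester_row k a =
  (\sum_(a < m - k) v a *: partial d (m - 1 - k - a)) * P +
  (\sum_(a < n - k) v (m - k + a)%N *: partial d (n - 1 - k - a)) * Q.
Proof.
have -> : (n + m - 2 * k = (m - k) + (n - k))%N by lia.
rewrite big_split_ord /= !mulr_suml; congr (_ + _); apply: eq_bigr => a _.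
  by rewrite /sylvester_row ltn_ord scalerAl.
by rewrite /sylvester_row ltnNge leq_addr /= addKn scalerAl.
Qed.

Lemma size_sylvester_row a : (size (sylvester_row k a) <= n + m - k)%N.
Proof.
have P0 : P != 0 by rewrite -size_poly_gt0 sP.
have Q0 : Q != 0 by rewrite -size_poly_gt0 sQ.
rewrite /sylvester_row; case: ifP => _.
  by rewrite size_diffop_mul ?partial_neq0 // size_partial sP; lia.
by rewrite size_diffop_mul ?partial_neq0 // size_partial sQ; lia.
Qed.

(** The last column repeats an earlier one while e is at most n + m - 1 - k, and is zero beyond.
    Hence the determinants give the coefficients of the subresultant at every exponent. *)
Lemma Smx_i_det_eq0 e : (k < e)%N -> \det (Smx_i n m k cP cQ e) = 0.
Proof.
move=> ke; rewrite -det_tr.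
have [lee|gte] := leqP e (n + m - 1 - k).
  have h1 : (n + m - 1 - k - e < n + m - 2 * k)%N by lia.
  have h2 : ((n + m - 2 * k).-1 < n + m - 2 * k)%N by lia.
  apply: (determinant_alternate (i1 := Ordinal h1) (i2 := Ordinal h2)).
    by apply/eqP => -[]; lia.
  move=> a; rewrite !mxE /= ltnn ifT; last by lia.
  by congr Sent; lia.
have h2 : ((n + m - 2 * k).-1 < n + m - 2 * k)%N by lia.
rewrite (expand_det_row _ (Ordinal h2)) big1 // => a _.
rewrite !mxE /= ltnn Sent_row nth_default ?mul0r //.
by apply: leq_trans (size_sylvester_row _) _; lia.
Qed.

Lemma Smx_i_expand : exists C : nat -> K, forall e,
  \det (Smx_i n m k cP cQ e) =
  (\sum_(a < n + m - 2 * k) C a *: sylvester_row k a)`_e.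
Proof.
have h2 : ((n + m - 2 * k).-1 < n + m - 2 * k)%N by lia.
pose j0 := Ordinal h2.
(* Only the last column depends on e, so its cofactors computed at e = 0 serve for every e. The
   default 0 merely extends [C] to all of nat. *)
pose C a := if insub a is Some i then cofactor (Smx_i n m k cP cQ 0) i j0 else 0.
exists C => e; rewrite (expand_det_col _ j0) coef_sum; apply: eq_bigr => a _.
rewrite coefZ mulrC /C valK mxE /= ltnn Sent_row; congr (_ * _).
rewrite /cofactor; congr (_ * \det _); apply/matrixP => i j; rewrite !mxE.
by rewrite ifT ?ifT //; have := neq_lift j0 j; rewrite -val_eqE /=;
   have := ltn_ord (lift j0 j); rewrite /=; lia.
Qed.

Lemma subresD_comb : exists U V, subresD k = U * P + V * Q.
Proof.
have [C EC] := Smx_i_expand.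
suff -> : subresD k = \sum_(a < n + m - 2 * k) C a *: sylvester_row k a.
  by rewrite sylvester_row_comb; do 2!eexists.
rewrite subresD_poly; apply/polyP => e; rewrite coef_poly -EC.
by case: ltnP => // /Smx_i_det_eq0 ->.
Qed.

Lemma size_subresD : (size (subresD k) <= k.+1)%N.
Proof. by rewrite subresD_poly size_poly. Qed.

Lemma subresD_coef : (subresD k)`_k = \det (Smx_i n m k cP cQ k).
Proof. by rewrite subresD_poly coef_poly ltnSn. Qed.

Hypothesis ideal_order :
  forall U V, U * P + V * Q != 0 -> (k < size (U * P + V * Q)%R)%N.
Hypothesis ideal_syzygy : forall U V, U * P + V * Q = 0 ->
  (size U <= m - k)%N -> (size V <= n - k)%N -> U = 0 /\ V = 0.

Lemma size_rev_sum (t : nat) (v : nat -> K) :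
  (size (\sum_(a < t) v a *: partial d (t - 1 - a))%R <= t)%N.
Proof.
apply: leq_trans (size_sum _ _ _) _; apply/bigmax_leqP => a _.
by apply: leq_trans (size_scale_leq _ _) _; rewrite size_partial; have := ltn_ord a; lia.
Qed.

Lemma coef_rev_sum (t : nat) (v : nat -> K) b : (b < t)%N ->
  (\sum_(a < t) v a *: partial d (t - 1 - a))`_(t - 1 - b) = v b.
Proof.
move=> bt; rewrite coef_sum (bigD1 (Ordinal bt)) //= coefZ coefXn eqxx mulr1.
rewrite big1 ?addr0 // => a; rewrite -val_eqE /= => ab.
rewrite coefZ coefXn (_ : _ == _ = false) ?mulr0 //.
by apply/eqP; have := ltn_ord a; lia.
Qed.

(** A left kernel vector of S_k^k gives a combination of the rows without terms ∂^e for e >= k.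
    [ideal_order] makes it zero, and [ideal_syzygy] then makes both cofactors, hence the vector,
    zero. *)
Lemma subresD_lead_neq0 : (subresD k)`_k != 0.
Proof.
rewrite subresD_coef; apply/det0P => -[v v0 vS].
pose w a := if insub a is Some i then v 0 i else 0.
have Ew (a : 'I_(n + m - 2 * k)) : w a = v 0 a by rewrite /w valK.
pose X := \sum_(a < n + m - 2 * k) w a *: sylvester_row k a.
have sX : (size X <= k)%N.
  apply/leq_sizeP => e ke.
  have [lee|gte] := leqP (n + m - k) e.
    rewrite coef_sum big1 // => a _; rewrite coefZ nth_default ?mulr0 //.
    exact: leq_trans (size_sylvester_row a) lee.
  (* The column of ∂^e; for e = k it is the last one, which in S_k^k is again the column of ∂^k. *)
  pose c := (n + m - 1 - k - e)%N.
  have hc : (c < n + m - 2 * k)%N by rewrite /c; lia.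
  have := congr1 (fun r : 'rV[K]_ _ => r 0 (Ordinal hc)) vS.
  rewrite !mxE => E; rewrite -[RHS]E coef_sum; apply: eq_bigr => a _.
  rewrite coefZ Ew mxE /= Sent_row; congr (_ * _`_ _).
  by case: ifP; rewrite /c; lia.
have EX := sylvester_row_comb w.
set U := (\sum_(a < m - k) w a *: _) in EX.
set V := (\sum_(a < n - k) w (m - k + a)%N *: _) in EX.
have EU : U = \sum_(a < m - k) w a *: partial d (m - k - 1 - a).
  by apply: eq_bigr => a _; rewrite (subnAC m 1).
have EV : V = \sum_(a < n - k) w (m - k + a)%N *: partial d (n - k - 1 - a).
  by apply: eq_bigr => a _; rewrite (subnAC n 1).
have X0 : U * P + V * Q = 0.
  apply/eqP; apply: contraT => /ideal_order; rewrite -EX -/X.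
  by rewrite ltnNge sX.
have [||U0 V0] := ideal_syzygy X0.
- by rewrite EU size_rev_sum.
- by rewrite EV (size_rev_sum _ (fun a => w (m - k + a)%N)).
case/negP: v0; apply/eqP/rowP => a; rewrite mxE -Ew.
have [lt|ge] := ltnP a (m - k).
  by rewrite -(coef_rev_sum w lt) -EU U0 coef0.
have lt : (a - (m - k) < n - k)%N by have := ltn_ord a; lia.
have := coef_rev_sum (fun a => w (m - k + a)%N) lt.
by rewrite -EV V0 coef0 subnKC.
Qed.

Lemma size_subresD_eq : size (subresD k) = k.+1.
Proof.
apply/eqP; rewrite eqn_leq size_subresD ltnNge; apply: contra subresD_lead_neq0.
by move=> le; rewrite nth_default.
Qed.

Lemma subresD_gcrd :
  [/\ exists C, P = C * subresD k, exists C, Q = C * subresD k &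
      exists U V, subresD k = U * P + V * Q].
Proof.
have [U [V E]] := subresD_comb; have s := size_subresD_eq.
have nz : subresD k != 0 by rewrite -size_poly_gt0 s.
have rem0 A B : drem (subresD k) (A * P + B * Q) = 0.
  set X := A * P + B * Q; apply/eqP; apply: contraT => r0.
  (* The remainder stays in DP + DQ, but its size is at most k, so [ideal_order] forces it to be
     0. *)
  have Er : drem (subresD k) X =
      (A - dquo (subresD k) X * U) * P + (B - dquo (subresD k) X * V) * Q.
    rewrite !mulrBl addrACA -!mulrA -opprD -mulrDr -E.
    by apply/eqP; rewrite eq_sym subr_eq [X in _ == X]addrC; apply/eqP; exact: ddivE.
  have := size_drem X nz; rewrite s ltnS leqNgt Er ideal_order //.
  by rewrite -Er.
split; last by exists U, V.
- by have := drem_eq0 (rem0 1 0); rewrite mul1r mul0r addr0; eexists; eassumption.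
- by have := drem_eq0 (rem0 0 1); rewrite mul1r mul0r add0r; eexists; eassumption.
Qed.
End Order.

Lemma subresD_eq0 k r : (k < n)%N -> (k < m)%N -> (k < r)%N ->
  (forall U V, U * P + V * Q != 0 -> (r < size (U * P + V * Q)%R)%N) ->
  subresD k = 0.
Proof.
move=> kn km kr A; have [U [V E]] := subresD_comb kn km.
apply/eqP; apply: contraT => nz; have := A U V; rewrite -E => /(_ nz).
by rewrite ltnNge (leq_trans (size_subresD k)).
Qed.
End Subresultants.

(** * Identifying the concrete operators over F(x) with the abstract ring *)

Section RatfunLink.
Variable F : fieldType.
Local Notation K := (ratfun F).

Definition ratder : derivation K := Derivation (@derKD F) (@derKM F).
Local Notation D := (diffop ratder).

(** The Leibniz formula for ∂^i c, by induction with Pascal's rule. *)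
Lemma iter_ddmul_monomial (c : K) i j :
  iter i (ddmul ratder) (c *: 'X^j) =
  \sum_(l < i.+1) ('C(i, l)%:R * iter l (@derK F) c) *: 'X^(i - l + j).
Proof.
elim: i => [|i IH]; first by rewrite big_ord1 bin0 mul1r subn0.
have dterm (l : nat) (a : K) : ddmul ratder (('C(i, l)%:R * a) *: 'X^(i - l + j)) =
    ('C(i, l)%:R * derK a) *: 'X^(i - l + j) + ('C(i, l)%:R * a) *: 'X^((i - l + j).+1).
  by rewrite ddmulZ ddmulXn mulr_natl -[derK a]/(ratder a) raddfMn /= mulr_natl.
rewrite iterS IH raddf_sum /=; under eq_bigr => l _ do rewrite dterm.
rewrite big_split /= [X in _ + X]big_ord_recl [RHS]big_ord_recl /=.
rewrite !subn0 addSn addrCA; congr (_ + _); first by rewrite !bin0.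
under [RHS]eq_bigr => l _ do rewrite /bump /= add1n subSS binS natrD mulrDl scalerDl.
rewrite big_split /= addrC [X in _ = X + _]big_ord_recr /= bin_small // mul0r scale0r addr0.
congr (_ + _); apply: eq_bigr => l _; rewrite /bump /= add1n; congr (_ *: 'X^_).
by have := ltn_ord l; lia.
Qed.

Lemma dmulE (P Q : dop F) : dmul P Q = ((P : D) * (Q : D) : D).
Proof.
rewrite [RHS]/(diffop_mul ratder P Q) /dmul /diffop_mul; apply: eq_bigr => i _.
rewrite -[Q in RHS]coefK poly_def.
have -> : iter i (ddmul ratder) (\sum_(j < size Q) Q`_j *: 'X^j) =
          \sum_(j < size Q) iter i (ddmul ratder) (Q`_j *: 'X^j).
  elim: (i : nat) => // k IH; rewrite iterS IH raddf_sum.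
  by apply: eq_bigr.
rewrite scaler_sumr; apply: eq_bigr => j _.
rewrite iter_ddmul_monomial scaler_sumr; apply: eq_bigr => l _.
by rewrite scalerA mulrA.
Qed.

Lemma dpowE (P : dop F) k : dpow P k = ((P : D) ^+ k : D).
Proof. by elim: k => [//|k IH]; rewrite exprS -IH; apply: dmulE. Qed.

Lemma dcoefE (P : dop F) j e : dcoef P j e = (partial ratder j * (P : D) : D)`_e.
Proof. by rewrite /dcoef dmulE. Qed.

Lemma ratder_injK c : ratder (injK c) = 0.
Proof. exact: derK_injK. Qed.

Lemma eval_opE (L M : D) (cML : GRing.comm M L) H :
  eval_op H L M = eval2D ratder_injK cML H.
Proof.
rewrite -[H in RHS]coefK poly_def raddf_sum /eval_op; apply: eq_bigr => i _ /=.
rewrite -mul_polyC rmorphM rmorphXn /= eval2DC eval2DX.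
rewrite -[H`_i in RHS]coefK poly_def raddf_sum mulr_suml; apply: eq_bigr => j _ /=.
rewrite -mul_polyC rmorphM rmorphXn /= eval1DC eval1DX constDE -!scalerAl mul1r.
by rewrite dmulE !dpowE.
Qed.

Lemma pchar_ratfun : [pchar F] =i pred0 -> [pchar ratfun F] =i pred0.
Proof. by move=> c0 p; rewrite (fmorph_pchar (@injK F)) c0. Qed.

Lemma dcoef_sub_const (L : dop F) l j e :
  (partial ratder j * ((L : D) - constD ratder (@injK F) l))`_e =
  dcoef L j e - (if e == j then injK l else 0).
Proof.
rewrite mulrBr coefB -dcoefE (mul_constD ratder_injK) coefZ coefXn.
by case: eqP; rewrite ?mulr1 ?mulr0.
Qed.

Lemma liftF_spec (f : {poly {poly F}}) l :
  map_poly (horner_eval (injK l)) (liftF f) = map_poly (@injK F) (spec l f).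
Proof.
apply/polyP => i; rewrite /liftF /spec !coef_map /= /horner_eval.
exact: horner_map.
Qed.

Lemma spec_swapXY (f : {poly {poly F}}) a : spec a (swapXY f) = f.[a%:P].
Proof.
elim/poly_ind: f => [|f p IH]; first by rewrite /spec !raddf0 horner0.
rewrite /spec !rmorphD !rmorphM /= -/(spec a _) IH swapXY_X swapXY_polyC !hornerE.
rewrite map_polyC /= {1}/horner_eval hornerX; congr (_ + _).
by apply/polyP => i; rewrite !coef_map /= /horner_eval hornerC.
Qed.

Lemma liftF_swap (f : {poly {poly F}}) a :
  (liftF f).[(injK a)%:P] = map_poly (@injK F) (spec a (swapXY f)).
Proof.
rewrite spec_swapXY /liftF -horner_map /=; congr _.[_].
by rewrite map_polyC.
Qed.

Section Curve.
Variables (n m : nat) (L M : D) (f : {poly {poly F}}).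
Hypotheses (sL : size L = n.+2) (sM : size M = m.+2).
Hypothesis Hf : liftF f = dres L M.

(** As l is constant, ∂^j (L - l) = ∂^j L - l ∂^j, so putting λ = l in the matrix of [dres] gives
    the Sylvester matrix of L - l and M - μ. *)
Lemma char_curve_dres : char_curve (@injK F) n L M f.
Proof.
move=> l; have sP := size_sub_const (@injK F) sL l.
have [c c0 E] := sylvester_char_poly sP sM.
exists c => //; rewrite -E -liftF_spec Hf /dres -det_map_mx /ord sL sM.
congr (\det _); apply/matrixP => i j; rewrite !mxE /Sent.
case: ifP => _.
  rewrite rmorphB /= map_polyC /= [horner_eval _ _]hornerC dcoef_sub_const polyCB.
  by congr (_ - _); case: ifP => _; rewrite ?raddf0 // /lam map_polyC /= [horner_eval _ _]hornerX.
rewrite rmorphB /= map_polyC /= [horner_eval _ _]hornerC dcoefE.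
by congr (_ - _); case: ifP => _; rewrite ?raddf0 // /mu map_polyX.
Qed.

Lemma char_curve_dres_swap : char_curve (@injK F) m M L (swapXY f).
Proof.
move=> a; have sP := size_sub_const (@injK F) sM a.
have [c c0 E] := sylvester_char_poly_swap sP sL.
exists c => //; rewrite -E -liftF_swap Hf /dres -/(horner_eval _ _) -det_map_mx /ord sL sM.
congr (\det _); apply/matrixP => i j; rewrite !mxE /Sent.
case: ifP => _.
  rewrite rmorphB /= /horner_eval hornerC dcoefE.
  by congr (_ - _); case: ifP => _; rewrite ?horner0 // /lam hornerC.
rewrite rmorphB /= /horner_eval hornerC dcoef_sub_const polyCB.
by congr (_ - _); case: ifP => _; rewrite ?horner0 // /mu hornerX.
Qed.
End Curve.
End RatfunLink.

(** * Assembly: s = r, the two order bounds at a nonsingular point, and the greatest common right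
    divisor *)

Lemma diffop_subE (K : fieldType) (d : derivation K) (P Q : {poly K}) :
  P - Q = ((P : diffop d) - (Q : diffop d)).
Proof. by []. Qed.

Lemma spec_horner (F : fieldType) (h : {poly {poly F}}) l a :
  (spec l h).[a] = eval2 h l a.
Proof.
have := horner_map (horner_eval l) h a%:P.
by rewrite /= [horner_eval l a%:P]hornerC.
Qed.

Lemma deriv_horner_polyC (F : fieldType) (h : {poly {poly F}}) a :
  (h.[a%:P])^`() = (map_poly (fun p : {poly F} => p^`()) h).[a%:P].
Proof.
rewrite (horner_coef_wide _ (size_poly _ _)) horner_coef raddf_sum.
apply: eq_bigr => i _ /=; rewrite coef_map_id0 ?deriv0 // -rmorphXn /= derivM derivC.
by rewrite mulr0 addr0.
Qed.

Lemma subresE (F : fieldType) n m (P Q : diffop (ratder F)) k :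
  size P = n.+1 -> size Q = m.+1 -> subres P Q k = subresD n m P Q k.
Proof.
move=> sP sQ; rewrite /subres /subresD /ord sP sQ; apply: eq_bigr => i _.
congr (\det _ *: _); apply/matrixP => a b; rewrite !mxE /Sent.
by case: ifP => _; rewrite dcoefE.
Qed.

Theorem mainTheorem2 (F : closedFieldType) (charF0 : [pchar F] =i pred0)
  (L M : dop F)
  (HL : (0 < ord L)%N) (HM : (0 < ord M)%N)
  (Hcomm : dmul L M = dmul M L)
  (Htrue : is_rank_alg L M (gcdn (ord L) (ord M)))
  (Hdef : (gcdn (ord L) (ord M) < minn (ord L) (ord M))%N)
  (f : {poly {poly F}}) (Hf : liftF f = dres L M)
  (h : {poly {poly F}}) (s : nat) (Hh : irreducible2 h) (Hfh : f = h ^+ s)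
  (l0 m0 : F) (Hpt : nonsingular_pt h l0 m0) :
  let r := gcdn (ord L) (ord M) in
  (forall k, (k < r)%N -> subres (L - cst l0) (M - cst m0) k = 0) /\
  ord (subres (L - cst l0) (M - cst m0) r) = r /\
  subres (L - cst l0) (M - cst m0) r != 0 /\
  is_gcrd (subres (L - cst l0) (M - cst m0) r) (L - cst l0) (M - cst m0).
Proof.
pose D := diffop (ratder F).
have cML : GRing.comm (M : D) (L : D).
  by move: Hcomm; rewrite !dmulE => /esym.
have [n sL] : exists n, size L = n.+2.
  by exists (size L).-2; move: HL; rewrite /ord; case: (size L) => [|[]].
have [m sM] : exists m, size M = m.+2.
  by exists (size M).-2; move: HM; rewrite /ord; case: (size M) => [|[]].
have oL : ord L = n.+1 by rewrite /ord sL.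
have oM : ord M = m.+1 by rewrite /ord sM.
move: Htrue Hdef; rewrite oL oM => Htrue Hdef /=; set r := gcdn _ _ in Htrue Hdef *.
have r0 : (0 < r)%N by rewrite gcdn_gt0.
have rn : (r %| n.+1)%N := dvdn_gcdl _ _.
have rm : (r %| m.+1)%N := dvdn_gcdr _ _.
have rk H : (r %| (size (eval2D (@ratder_injK F) cML H)).-1)%N.
  by rewrite -eval_opE; apply: Htrue.1.
have cf := char_curve_dres sL sM Hf; have cf' := char_curve_dres_swap sL sM Hf.
rewrite Hfh in cf; rewrite Hfh rmorphXn /= in cf'.
have evh : eval2D (@ratder_injK F) cML h = 0.
  apply: (@diffop_expf_eq0 _ _ _ s); rewrite -rmorphXn /=.
  exact: (char_curve_vanish (@ratder_injK F) cML sL charF0 cf).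
(* The degrees of f(l0, μ) and f(λ, m0) give s | ord L and s | ord M, hence s | r. Conversely ord L
   = s deg h(l0, μ) <= s (ord L / r), so r <= s. *)
have sr : s = r.
  have dn := char_curve_degree l0 cf; have dm := char_curve_degree m0 cf'.
  have sn : (s %| n.+1)%N by rewrite dn dvdn_mulr.
  have sm : (s %| m.+1)%N by rewrite dm dvdn_mulr.
  have sdr : (s %| r)%N by rewrite dvdn_gcd sn sm.
  have dK (u : ratfun F) : ratder F u = 0 -> exists c, u = injK c.
    exact: derK_eq0.
  have szh := spectral_size_le dK (pchar_ratfun charF0)
                sL sM (ltn0Sn n) r0 rn rm rk Hh evh.
  have szs : (size (spec l0 h) <= size h)%N := size_poly _ _.
  have En : n.+1 = (n.+1 %/ r * r)%N by rewrite divnK.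
  have q0 : (0 < n.+1 %/ r)%N by rewrite divn_gt0 // dvdn_leq.
  apply/eqP; rewrite eqn_leq (dvdn_leq r0 sdr) /=.
  rewrite -(leq_pmul2l q0) -En {1}dn mulnC leq_mul2r; apply/orP; right.
  by have := leq_trans szs szh; case: (size (spec l0 h)).
pose P : D := (L : D) - constD (ratder F) (@injK F) l0.
pose Q : D := (M : D) - constD (ratder F) (@injK F) m0.
have sP : size P = n.+2 := size_sub_const (@injK F) sL l0.
have sQ : size Q = m.+2 := size_sub_const (@injK F) sM m0.
have [A B] : (forall U V : D, U * P + V * Q != 0 -> (r < size (U * P + V * Q)%R)%N) /\
    (forall U V : D, U * P + V * Q = 0 -> (size U <= m.+1 - r)%N ->
       (size V <= n.+1 - r)%N -> U = 0 /\ V = 0).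
  (* If the λ-derivative is nonzero, l0 is a simple root of h(λ, m0) and the exchanged pair M, L
     applies, using the bound on U. Otherwise m0 is a simple root of h(l0, μ), and the bound on V is
     used. *)
  rewrite -sr; case: Hpt => pt [dl|dm].
    have cLM : GRing.comm (L : D) (M : D) := esym cML.
    have [||A B] := simple_point_ideal (@ratder_injK F) cLM sM charF0
                      (h := swapXY h) cf' (l := m0) (a := l0).
    - by rewrite spec_swapXY rootE -[_.[_]]/(eval2 h l0 m0) pt.
    - by rewrite spec_swapXY deriv_horner_polyC.
    split=> U V; first by rewrite addrC; apply: A.
    by rewrite addrC => /B E leU _; case: (E leU).
  have [||A B] := simple_point_ideal (@ratder_injK F) cML sL charF0 cf (l := l0) (a := m0).
  - by rewrite rootE spec_horner pt.
  - by rewrite /spec deriv_map -/(spec l0 _) rootE spec_horner.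
  by split=> // U V E _; apply: B.
have [rn' rm'] : (r < n.+1)%N /\ (r < m.+1)%N by move: Hdef; rewrite leq_min => /andP[].
(* The left side subtracts in [{poly ratfun F}], the right side in D; the additive structures
   coincide. *)
have EP : L - cst l0 = P := diffop_subE (ratder F) L (cst l0).
have EQ : M - cst m0 = Q := diffop_subE (ratder F) M (cst m0).
rewrite EP EQ; clearbody P Q; have ES k := subresE k sP sQ.
have sz := size_subresD_eq sP sQ rn' rm' A B.
have [[C1 E1] [C2 E2] [U [V E]]] := subresD_gcrd sP sQ rn' rm' A B.
split=> [k kr|].
  by rewrite ES (subresD_eq0 sP sQ (ltn_trans kr rn') (ltn_trans kr rm') kr A).
rewrite ES /ord sz; split=> //; split; first by rewrite -size_poly_gt0 sz.
split; first by exists C1; rewrite dmulE; exact: E1.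
split; first by exists C2; rewrite dmulE; exact: E2.
move=> X [Y1 EY1] [Y2 EY2]; rewrite dmulE in EY1; rewrite dmulE in EY2.
(* With P = Y1 X and Q = Y2 X, this is the cofactor of X in U P + V Q. *)
exists ((U : D) * Y1 + (V : D) * Y2 : D); rewrite dmulE E mulrDl -!mulrA.
by rewrite -EY1 -EY2.
Qed.
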